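(* Let $k\ge 3$ and let $K$ be a field of characteristic $0$. Let $n_1,\dots,n_k,r\in\mathbb{N}$ satisfy $Q(n_1,\dots,n_k)<r$ and $r\le n_i$ for all $i=1,\dots,k$. Then $$\dim\left(\mathcal{C}_r^{(n_1,\dots,n_k)}\right)=\prod_{i=1}^k n_i-r\left(r^{k-1}-\sum_{i=1}^k n_i+(k-1)\right),$$ where $\mathcal{C}_r^{(n_1,\dots,n_k)}\subseteq K^{n_1}\otimes\cdots\otimes K^{n_k}$ is the set of tensors of subrank at least $r$ and $Q(n_1,\dots,n_k)$ is the generic subrank.
   Context: $\mathbb{N}$ denotes the positive integers. Write $K^{n_1,\dots,n_k}:=K^{n_1}\otimes\cdots\otimes K^{n_k}$. For tensors $S\in K^{m_1,\dots,m_k}$ and $T\in K^{n_1,\dots,n_k}$ write $S\le T$ if there are linear maps $A_i:K^{n_i}\to K^{m_i}$ with $(A_1\otimes\cdots\otimes A_k)T=S$. For $s\ge 0$ let $I_s=\sum_{j=1}^s e_j\otimes\cdots\otimes e_j$ ($k$ factors, $e_1,\dots,e_s$ the standard basis of $K^s$) be the unit tensor of size $s$. The subrank $Q(T)$ of $T\in K^{n_1,\dots,n_k}$ is the largest integer $s\ge 0$ with $I_s\le T$. Let $\mathcal{C}_r^{(n_1,\dots,n_k)}=\{T\in K^{n_1,\dots,n_k} : Q(T)\ge r\}$; its dimension is the dimension of its Zariski closure in the affine space $K^{n_1,\dots,n_k}$. The generic subrank $Q(n_1,\dots,n_k)$ is the largest $r$ such that $\mathcal{C}_r^{(n_1,\dots,n_k)}$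 is Zariski-dense in $K^{n_1,\dots,n_k}$. *)

(* Defs.v *)
From HB Require Import structures.
From mathcomp Require Import all_boot all_order all_algebra.
From mathcomp Require Import boolp classical_sets.
From mathcomp Require Import mpoly.

Set Implicit Arguments.
Unset Strict Implicit.
Unset Printing Implicit Defensive.

Import GRing.Theory.
Local Open Scope classical_set_scope.
Local Open Scope ring_scope.

(* Junk value 0 when there is no largest element. *)
Definition largest (P : set nat) : nat :=
  xget 0%N [set s | P s /\ forall t, P t -> (t <= s)%N].

Section AffineGeometry.
Variables (K : fieldType) (I : finType).

(* The affine space K^I is {ffun I -> K}; its coordinate ring is
   {mpoly K[#|I|]}, the j-th variable being the coordinate enum_val j : I. *)
Definition peval (p : {mpoly K[#|I|]}) (x : {ffun I -> K}) : K :=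
  p.@[fun j => x (enum_val j)].

Definition zero_locus (S : set {mpoly K[#|I|]}) : set {ffun I -> K} :=
  [set x | forall p, S p -> peval p x = 0].

Definition vanishing_ideal (X : set {ffun I -> K}) : set {mpoly K[#|I|]} :=
  [set p | forall x, X x -> peval p x = 0].

Definition zariski_closed (X : set {ffun I -> K}) : Prop :=
  exists S, X = zero_locus S.

Definition zariski_closure (X : set {ffun I -> K}) : set {ffun I -> K} :=
  smallest zariski_closed X.

Definition zariski_dense (X : set {ffun I -> K}) : Prop :=
  zariski_closure X = setT.

Definition prime_ideal (P : set {mpoly K[#|I|]}) : Prop :=
  idealr_closed (mem P) /\ prime_idealr_closed (mem P).

(* The primes of the coordinate ring K[x]/I(X) are the primes of K[x] that
   contain I(X). Over a field that is not algebraically closed, chains of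
   irreducible closed subsets of K-points could be too short (a simple abelian
   surface over the rationals with dense rational points), hence prime
   ideals. *)
Definition prime_chain (X : set {ffun I -> K}) (d : nat) : Prop :=
  exists P : nat -> set {mpoly K[#|I|]},
    (forall i, (i <= d)%N -> prime_ideal (P i) /\ vanishing_ideal X `<=` P i)
    /\ (forall i, (i < d)%N -> P i `<` P i.+1).

(* Krull dimension of the coordinate ring of a closed set X. The chain lengths
   are bounded by #|I|, so the maximum exists unless X is empty. *)
Definition closed_dim (X : set {ffun I -> K}) : nat := largest (prime_chain X).

Definition zariski_dim (X : set {ffun I -> K}) : nat :=
  closed_dim (zariski_closure X).

End AffineGeometry.

Section Tensors.
Variables (K : fieldType) (k : nat).

Definition midx (n : 'I_k -> nat) : finType :=
  {dffun forall i : 'I_k, 'I_(n i)}.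

(* K^(n_1) (x) ... (x) K^(n_k), in coordinates for the standard basis. *)
Definition tensor (n : 'I_k -> nat) := {ffun midx n -> K}.

(* (A_1 (x) ... (x) A_k) T, with A_i acting on column vectors. *)
Definition tensor_act (m n : 'I_k -> nat)
    (A : forall i, 'M[K]_(m i, n i)) (T : tensor n) : tensor m :=
  [ffun a : midx m => \sum_(b : midx n) (\prod_(i < k) A i (a i) (b i)) * T b].

Definition restricts (m n : 'I_k -> nat) (S : tensor m) (T : tensor n) : Prop :=
  exists A : forall i, 'M[K]_(m i, n i), tensor_act A T = S.

Definition unit_tensor (s : nat) : tensor (fun _ => s) :=
  [ffun a : midx (fun _ => s) => \sum_(j < s) \prod_(i < k) (a i == j)%:R].

Definition subrank (n : 'I_k -> nat) (T : tensor n) : nat :=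
  largest [set s | restricts (unit_tensor s) T].

Definition subrank_ge (n : 'I_k -> nat) (r : nat) : set (tensor n) :=
  [set T | (r <= subrank T)%N].

Definition generic_subrank (n : 'I_k -> nat) : nat :=
  largest [set r | zariski_dense (subrank_ge (n := n) r)].

End Tensors.

Arguments unit_tensor K k s : clear implicits.
Arguments subrank_ge K {k} n r.
Arguments generic_subrank K {k} n.

(* Main.v *)
Require Import Defs.
From mathcomp Require Import all_boot all_order all_algebra.
From mathcomp Require Import boolp classical_sets.
From mathcomp Require Import mpoly.
From mathcomp Require Import fingroup perm fraction generic_quotient zify ring.

Set Implicit Arguments.
Unset Strict Implicit.
Unset Printing Implicit Defensive.

Import GRing.Theory.
Local Open Scope ring_scope.

(**
The idea is to parametrize the tensors of subrank at least r, up to Zariski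
closure, by exactly as many parameters as the claimed dimension, and to compute
the rank of the parametrization at one well chosen point.

Parametrization. A tensor T has subrank at least r iff some r x n_i matrices
A_i turn it into the unit tensor. These matrices have rank r, and for generic
coordinates their leading r x r blocks are invertible; then T is
(N_1 (x) ... (x) N_k) S, where S is the unit tensor on the box [r]^k and is
arbitrary outside, and N_i is the identity below its first r rows. The torus of
diagonal matrices fixing the unit tensor lets one moreover make the r diagonal
entries of the top block of N_i equal to 1, for every i but one index i0. The
number of the remaining parameters is
  (prod n_i - r^k) + r sum n_i - (k - 1) r,
the claimed dimension ([card_free_parameters]), and the ideal of the polynomial
relations among the coordinates of this family is the vanishing ideal of the
set of tensors of subrank at least r ([ideal_of_subrank_ge]).

Jacobian. Differentiate the family where all N_i are identities. The free
entries of S move the entries outside the box independently, so everything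
happens in the box [r]^k. There the entry (x, l) of N_i contributes, at the
points a with a_i = x, the slice l of S in direction i. For l < r it is a slice
of the unit tensor, and these slices span the functions on the points all but
one of whose coordinates agree (near-diagonal points). For l >= r it is an
arbitrary function w_(i,l) on the lines of direction i. With m_i = n_i - r,
what remains is the linear map
  (kappa_(i,j)) |-> sum_(i,j) kappa_(i,j)(a_i) w_(i,j)(a)
from r * sum m_i unknowns to the functions on the other (far) points. The key
fact is that it has maximal rank for suitable w ([exists_transverse_lines]).

If it is onto, the Jacobian is onto, so the coordinates of the family are
algebraically independent ([jacobian_independence]); then the tensors of
subrank at least r are dense, against the hypothesis on the generic subrank. So
it is one-to-one, and so is the Jacobian. A family with d parameters whose
Jacobian has rank d at some point has dimension d ([zariski_dim_parametrized]):
d + 1 polynomials in d variables are algebraically dependent, which bounds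
chains of primes, and freezing the parameters one after the other produces a
chain of length d.

Key fact. Adding or removing some w_(i,j), one may assume that r * sum m_i is
the number of far points; every slice then has c = sum m_i far points. Take
the w_(i,j) with indeterminate values, and suppose that a nonzero function phi
on the far points, with values in the fraction field, is orthogonal to the
image: the contraction of phi with each w_(i,j) along every slice of direction
i vanishes. Let beta_i be the rank of the flattening of phi in direction i, and
let i0 minimize it. Differentiating the orthogonality relations with respect to
the indeterminate w_(i,j)(b) shows that the contraction of d phi / d w_(i,j)(b)
with w_(i',j') is 0 if (i',j') is not (i,j), and is - phi(., b) otherwise.
Hence phi, together with its derivatives along w_(i,j)(b) for b in a column
basis of the flattening, form a family of 1 + sum m_i beta_i > beta_i0 * c
linearly independent functions. But they all are supported on far points and
tangent to the variety of functions whose flattening in direction i0 has rank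
beta_i0, and far support forces this tangent space to have dimension at most
beta_i0 * c: contradiction ([generic_vectors_span]). The last bound comes from
writing each slice x of phi as a combination, with coefficients lambda(x,z), of
slices z in a row basis: a tangent function is determined by its values on
these slices and by the variation of the nonzero lambda(x,z), and each of these
variations is compensated by a relation, coming from the vanishing at the
near-diagonal point (x; y; x, ..., x) for some y ([pivots_exist]).
*)

(** * Finite linear systems *)

Lemma underdetermined_system (F : fieldType) (I J : finType) (A : I -> J -> F) :
  (#|I| < #|J|)%N ->
  exists2 c : J -> F, (exists j, c j != 0) &
    forall i, \sum_j A i j * c j = 0.
Proof.
move=> ltIJ; pose M := \matrix_(j < #|J|, i < #|I|) A (enum_val i) (enum_val j).
have : kermx M != 0.
  rewrite -mxrank_eq0 mxrank_ker subn_eq0 -ltnNge.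
  exact: leq_ltn_trans (rank_leq_col _) ltIJ.
case/rowV0Pn=> v /sub_kermxP vM v_neq0.
exists (fun j => v 0 (enum_rank j)).
  case/rV0Pn: v_neq0 => j vj; exists (enum_val j).
  by rewrite enum_valK.
move=> i; have := congr1 (fun u : 'rV_ _ => u 0 (enum_rank i)) vM.
rewrite !mxE => vMi; rewrite -[RHS]vMi.
rewrite [RHS](reindex enum_rank) /=; last by apply: onW_bij; apply: enum_rank_bij.
by apply: eq_bigr => j _; rewrite mxE !enum_rankK mulrC.
Qed.

(** The flattening M is given by a row basis S and by as many columns b on which
its rows have no nontrivial relation; both come from maximal minors. *)
Lemma rank_factorization (F : fieldType) (I J : finType) (M : I -> J -> F) :
  exists (S : {set I}) (b : 'I_#|S| -> J) (lam : I -> I -> F),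
    (forall x y, M x y = \sum_(z in S) lam x z * M z y) /\
    (forall c : 'I_#|S| -> F,
       (forall x, \sum_t c t * M x (b t) = 0) -> forall t, c t = 0).
Proof.
pose A := \matrix_(i < #|I|, j < #|J|) M (enum_val i) (enum_val j).
pose f := maxrankfun A; pose g := maxrankfun A^T.
pose S := [set enum_val (f t) | t in 'I_(\rank A)].
have injf : injective (fun t => enum_val (f t)).
  by move=> s t /enum_val_inj/maxrankfun_inj.
have cardS : #|S| = \rank A by rewrite card_imset // card_ord.
have cardS' : #|S| = \rank A^T by rewrite mxrank_tr.
exists S, (fun t => enum_val (g (cast_ord cardS' t))).
have spanA x : exists lam : I -> F,
    forall y, M x y = \sum_(z in S) lam z * M z y.
  have : (row (enum_rank x) A <= rowsub f A)%MS.
    by rewrite eq_maxrowsub row_sub.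
  case/submxP=> D AD.
  exists (fun z => \sum_t D 0 t * (enum_val (f t) == z)%:R) => y.
  have := congr1 (fun u : 'rV_ _ => u 0 (enum_rank y)) AD.
  rewrite !mxE !enum_rankK => ->.
  rewrite /S big_imset /=; last by move=> s t _ _; apply: injf.
  apply: eq_bigr => t _; rewrite !mxE enum_rankK; congr (_ * _).
  rewrite (bigD1 t) //= eqxx mulr1 big1 ?addr0 // => s /negPf nst.
  by rewrite (inj_eq injf) nst mulr0.
exists (fun x => projT1 (cid (spanA x))); split.
  by move=> x y; apply: (projT2 (cid (spanA x))).
move=> c c0 t.
have := maxrowsub_free A^T; rewrite -kermx_eq0 => /eqP ker0.
pose v := \row_s c (cast_ord (esym cardS') s).
have : (v <= kermx (rowsub g A^T))%MS.
  apply/sub_kermxP/rowP => x; rewrite !mxE -[RHS](c0 (enum_val x)).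
  rewrite (reindex (cast_ord cardS')) /=; last first.
    by apply: onW_bij; apply: (Bijective (cast_ordK _) (cast_ordKV _)).
  by apply: eq_bigr => s _; rewrite !mxE cast_ordK.
rewrite ker0 submx0 => /eqP/rowP/(_ (cast_ord cardS' t)).
by rewrite !mxE cast_ordK.
Qed.

(** * Points of a box and the near-diagonal points *)

Section Update.
Variables (k : nat) (n : 'I_k -> nat).

Definition upd (a : midx n) (i : 'I_k) (x : 'I_(n i)) : midx n :=
  finfun (dfwith a x).

Lemma upd_same a i (x : 'I_(n i)) : upd a x i = x.
Proof. by rewrite ffunE dfwith_in. Qed.

Lemma upd_other a i (x : 'I_(n i)) j : j != i -> upd a x j = a j.
Proof. by move=> ji; rewrite ffunE dfwith_out // eq_sym. Qed.

Lemma eq_midx (a b : midx n) : (forall j, a j = b j) -> a = b.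
Proof. by move=> ab; apply/ffunP. Qed.

Lemma neq_midx (a b : midx n) : a != b -> exists i, a i != b i.
Proof.
move=> ab; apply/existsP; apply: contraNT ab; rewrite negb_exists => /forallP ab.
by apply/eqP/eq_midx => i; apply/eqP; have := ab i; rewrite negbK.
Qed.

Lemma upd_id a i : upd a (a i) = a.
Proof.
by apply: eq_midx => j; have [->|ji] := eqVneq j i; rewrite ?upd_same ?upd_other.
Qed.

Lemma upd_upd a i (x y : 'I_(n i)) : upd (upd a x) y = upd a y.
Proof.
apply: eq_midx => j; have [->|ji] := eqVneq j i; first by rewrite !upd_same.
by rewrite !upd_other.
Qed.

End Update.
Arguments upd {k n} a i x.

Section NearDiagonal.
Variables (k r : nat).
Notation point := (midx (fun _ : 'I_k => r)).

(** The supports of the tensors obtained from the unit tensor by moving one of its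
slices to another place in the same direction consist of such points. The other
points are called far. *)
Definition near_diag (a : point) : bool :=
  [exists i, exists l, [forall j, (j != i) ==> (a j == l)]].

Lemma near_diagP (a : point) :
  reflect (exists i l, forall j, j != i -> a j = l) (near_diag a).
Proof.
apply: (iffP existsP) => [[i /existsP[l /forallP al]]|[i [l al]]].
  by exists i, l => j ji; have /implyP/(_ ji)/eqP := al j.
by exists i; apply/existsP; exists l; apply/forallP => j; apply/implyP => /al ->.
Qed.

(** Permuting the r values maps the slices of a given direction to one another
and preserves the near-diagonal points. *)
Lemma card_slice (i : 'I_k) (x : 'I_r) :
  (r * #|[set a : point | ~~ near_diag a & a i == x]| = #|[set a | ~~ near_diag a]|)%N.
Proof.
pose act (s : {perm 'I_r}) (a : point) : point := finfun (fun j => s (a j)).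
have actK s : cancel (act s) (act s^-1%g).
  by move=> a; apply: eq_midx => j; rewrite !ffunE permK.
have nd_sub s a : near_diag a -> near_diag (act s a).
  case/near_diagP=> j [l al]; apply/near_diagP; exists j, (s l) => j' /al <-.
  by rewrite ffunE.
have nd_act s a : near_diag (act s a) = near_diag a.
  by apply/idP/idP; [rewrite -{2}[a](actK s); apply: nd_sub | apply: nd_sub].
have cardE y : #|[set a : point | ~~ near_diag a & a i == y]| =
               #|[set a : point | ~~ near_diag a & a i == x]|.
  pose s : {perm 'I_r} := tperm x y.
  rewrite -(card_imset [set a : point | ~~ near_diag a & a i == x] (can_inj (actK s))).
  congr #|pred_of_set _|; apply/setP => a; apply/idP/imsetP.
    rewrite inE => /andP[nda /eqP ay]; exists (act s a).
      by rewrite inE nd_act nda ffunE ay tpermR eqxx.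
    have -> : s = s^-1%g by rewrite tpermV.
    by have := actK s^-1%g a; rewrite invgK tpermV => ->.
  case=> b; rewrite inE => /andP[ndb /eqP bx] ->.
  by rewrite inE nd_act ndb ffunE bx tpermL eqxx.
transitivity (\sum_(y < r) #|[set a : point | ~~ near_diag a & a i == y]|)%N.
  by rewrite (eq_bigr _ (fun y _ => cardE y)) sum_nat_const card_ord.
under eq_bigr => y _ do rewrite -sum1dep_card.
rewrite -sum1dep_card.
rewrite [RHS](partition_big (fun a : point => a i) xpredT) //=.
Qed.

End NearDiagonal.

Lemma avoid_seq (q : nat) (s : seq 'I_q) :
  (size s < q)%N -> exists i, i \notin s.
Proof.
move=> lt_sq; apply/existsP; apply: contraLR lt_sq.
rewrite negb_exists -leqNgt => /forallP all_s.
rewrite -[X in (X <= _)%N]card_ord cardE.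
by apply: uniq_leq_size (enum_uniq _) _ => i _; have := all_s i; rewrite negbK.
Qed.

Section Pivots.
Variables (k r : nat) (k_ge3 : (3 <= k)%N).
Notation point := (midx (fun _ : 'I_k => r)).
Variables (i0 i1 : 'I_k) (i10 : i1 != i0).

(** In the exceptional case k = 3, r <= 2 all points are near-diagonal, two of the
three coordinates being equal. *)
Lemma far_point_bound (a : point) : ~~ near_diag a -> (4 <= k)%N || (3 <= r)%N.
Proof.
have [//|k4] := leqP 4 k; have [//|r3] := leqP 3 r; apply: contraNT => _.
have [i2 i2N] : exists i2, i2 \notin [:: i0; i1] by apply: avoid_seq.
have cases j : j \in [:: i0; i1; i2].
  apply: contraTT k4 => jN; rewrite -ltnNge ltnS -[k]card_ord.
  have /card_uniqP : uniq [:: j; i2; i0; i1].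
    move: jN i2N; rewrite /= !inE !negb_or => /and3P[-> -> ->] /andP[-> ->] /=.
    by rewrite eq_sym i10.
  by rewrite /= => <-; apply: max_card.
move: i2N; rewrite !inE negb_or => /andP[i20 i21].
apply/near_diagP.
have pig (x y z : 'I_r) : [|| x == y, y == z | z == x].
  by case: x y z => x ltx [y lty] [z ltz]; rewrite -!val_eqE /=; clear -ltx lty ltz r3; lia.
case/or3P: (pig (a i0) (a i1) (a i2)) => /eqP e.
- by exists i2, (a i1) => j; move: (cases j); rewrite !inE => /or3P[] /eqP-> //; rewrite eqxx.
- by exists i0, (a i2) => j; move: (cases j); rewrite !inE => /or3P[] /eqP-> //; rewrite eqxx.
- by exists i1, (a i0) => j; move: (cases j); rewrite !inE => /or3P[] /eqP-> //; rewrite eqxx.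
Qed.

(** The points that differ from the diagonal point x at two places at most. For
p = x they are near-diagonal; moving p gives the pivots below. *)
Definition corner (p y x : 'I_r) : point :=
  finfun (fun j => if j == i0 then p else if j == i1 then y else x).

Lemma corner0 p y x : corner p y x i0 = p.
Proof. by rewrite ffunE eqxx. Qed.

Lemma corner1 p y x : corner p y x i1 = y.
Proof. by rewrite ffunE (negPf i10) eqxx. Qed.

Lemma corner2 p y x j : j != i0 -> j != i1 -> corner p y x j = x.
Proof. by move=> /negPf j0 /negPf j1; rewrite ffunE j0 j1. Qed.

Lemma upd_corner p y x z : upd (corner p y x) i0 z = corner z y x.
Proof.
apply: eq_midx => j; have [->|j0] := eqVneq j i0; first by rewrite upd_same corner0.
by rewrite upd_other // !ffunE (negPf j0).
Qed.

Lemma near_diag_corner y x : near_diag (corner x y x).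
Proof.
apply/near_diagP; exists i1, x => j ji; rewrite ffunE.
by case: eqP => // _; rewrite (negPf ji).
Qed.

Lemma corner_far p y x : p != x -> y != x -> (p != y) || (4 <= k)%N ->
  ~~ near_diag (corner p y x).
Proof.
move=> px yx py; apply/near_diagP => -[i [l al]].
have [i2] : exists i2, i2 \notin [:: i0; i1] by apply: avoid_seq.
rewrite !inE negb_or => /andP[i20 i21].
have a2 := corner2 p y x i20 i21.
have a0 := corner0 p y x; have a1 := corner1 p y x.
have l2 : i2 != i -> l = x by move=> /al; rewrite a2.
have l0 : i0 != i -> l = p by move=> /al; rewrite a0.
have l1 : i1 != i -> l = y by move=> /al; rewrite a1.
have [e|/l0 lp] := eqVneq i0 i.
  by move: l1 l2; rewrite -e => /(_ i10) ly /(_ i20) lx; rewrite -ly -lx eqxx in yx.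
have [e|/l1 ly] := eqVneq i1 i.
  by move: l2; rewrite -e => /(_ i21) lx; rewrite -lp -lx eqxx in px.
have [e|/l2 lx] := eqVneq i2 i; last by rewrite -lp -lx eqxx in px.
have k4 : (4 <= k)%N by move: py; rewrite -lp -ly eqxx.
have [i3] : exists i3, i3 \notin [:: i0; i1; i2] by apply: avoid_seq.
rewrite !inE !negb_or => /and3P[i30 i31 i32].
have := al i3; rewrite -e i32 corner2 // => /(_ isT) xl.
by rewrite -lp -xl eqxx in px.
Qed.

(** Here Z is the support of a row of coefficients lambda(x, .). For each z in Z
one chooses a near-diagonal point corner x (y z) x on the slice x, and a far
point corner (p z) (y z) x above it on a slice p z in Z. Distinct values y z
make these points lie on distinct lines of direction i0. One takes y z = z; the
point is far if p z differs from z, or for any p z if k >= 4, so that only a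
singleton Z with k = 3 needs another y z, which r >= 3 makes possible. *)
Lemma pivots_exist (x : 'I_r) (Z : {set 'I_r}) (a : point) :
  ~~ near_diag a -> x \notin Z ->
  exists y p : 'I_r -> 'I_r, {in Z &, injective y} /\
    forall z, z \in Z ->
      [/\ y z != x, p z \in Z & ~~ near_diag (corner (p z) (y z) x)].
Proof.
move=> nda xZ.
have neqx z : z \in Z -> z != x by apply: contraTneq => ->.
have [Z_le1|Z_gt1] := leqP #|Z| 1.
  have Z1 := card_le1_eqP Z_le1.
  have [k4|k_lt4] := leqP 4 k.
    exists id, id; split=> // z Zz; split=> //; first exact: neqx.
    by apply: corner_far; rewrite ?neqx ?k4 ?orbT.
  have r3 : (3 <= r)%N by have := far_point_bound nda; rewrite leqNgt k_lt4.
  have [Z0|[z0 Zz0]] := set_0Vmem Z.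
    by exists id, id; split=> // z; rewrite Z0 inE.
  have [u] : exists u, u \notin [:: x; z0] by apply: avoid_seq.
  rewrite !inE negb_or => /andP[ux uz0].
  exists (fun=> u), id; split=> [s t Zs Zt _|z Zz]; first exact: Z1.
  split=> //; apply: corner_far; rewrite ?ux ?(neqx z) //.
  by have <- : z0 = z by [apply: Z1]; rewrite eq_sym uz0.
exists id, (fun z => odflt z [pick u in Z :\ z]); split=> // z Zz.
split; first exact: neqx.
  by case: pickP => [u|_ //]; rewrite !inE => /andP[].
case: pickP => [u|no_u] /=.
  by rewrite !inE => /andP[uz Zu]; apply: corner_far; rewrite ?neqx // uz.
have Z0 : #|Z :\ z| = 0%N by apply: eq_card0.
by move: Z_gt1; rewrite (cardsD1 z Z) Zz Z0.
Qed.

End Pivots.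

Lemma dependent_choice_fun (I : Type) (T : I -> Type) (P : forall i, T i -> Prop) :
  (forall i, exists t, P i t) -> exists f : forall i, T i, forall i, P i (f i).
Proof.
by move=> exP; exists (fun i => projT1 (cid (exP i))) => i; exact: projT2 (cid (exP i)).
Qed.

(** * Contraction with generic vectors *)

(** The entries of the w_(i,j) are algebraically independent, which is
expressed by derivations D j b of the field F dual to these entries: the entry
of w_(i,j) at a depends on the line of direction i through a, and b stands for any
point of this line. *)
Section GenericVectors.
Variables (k r : nat) (F : fieldType) (k_ge3 : (3 <= k)%N) (r_gt0 : (0 < r)%N).
Notation point := (midx (fun _ : 'I_k => r)).
Variables (m : 'I_k -> nat) (w : forall i, 'I_(m i) -> point -> F).
Variable D : forall i, 'I_(m i) -> point -> F -> F.
Notation tag i j := (Tagged (fun i => 'I_(m i)) (j : 'I_(m i))).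
Hypothesis DD : forall i (j : 'I_(m i)) b, {morph D j b : x y / x + y}.
Hypothesis DM : forall i (j : 'I_(m i)) b x y,
  D j b (x * y) = D j b x * y + x * D j b y.
Hypothesis Dw : forall i (j : 'I_(m i)) b i' (j' : 'I_(m i')) (a : point),
  D j b (w j' a) = ((tag i j == tag i' j') && (upd b i (a i) == a))%:R.
Hypothesis count : (r * \sum_i m i = #|[set a : point | ~~ near_diag a]|)%N.
Variable phi : point -> F.
Hypothesis phi_diag : forall a, near_diag a -> phi a = 0.
Hypothesis phi_w : forall i (j : 'I_(m i)) x, \sum_(a : point | a i == x) w j a * phi a = 0.

Let D0 i (j : 'I_(m i)) b : D j b 0 = 0.
Proof. by apply: (addrI (D j b 0)); rewrite -DD !addr0. Qed.

Let D_sum i (j : 'I_(m i)) b I (s : seq I) (P : pred I) (f : I -> F) :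
  D j b (\sum_(u <- s | P u) f u) = \sum_(u <- s | P u) D j b (f u).
Proof. exact: (big_morph _ (DD j b) (D0 j b)). Qed.

Let card_far_slice i x :
  #|[set a : point | ~~ near_diag a & a i == x]| = (\sum_i m i)%N.
Proof.
apply/eqP; rewrite -(eqn_pmul2l r_gt0) count; apply/eqP; exact: card_slice.
Qed.

(** Differentiate the relation phi_w. *)
Let contract_D i (j : 'I_(m i)) b i' (j' : 'I_(m i')) x :
  \sum_(a : point | a i' == x) w j' a * D j b (phi a) =
  - ((tag i j == tag i' j')%:R * phi (upd b i x)).
Proof.
have := congr1 (D j b) (phi_w j' x); rewrite D0 D_sum.
under eq_bigr => a _ do rewrite DM Dw.
rewrite big_split /= => /eqP; rewrite addrC addr_eq0 => /eqP ->; congr (- _).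
case: eqP => [e|_]; last by rewrite mul0r big1 // => a _; rewrite mul0r.
have ei : i = i' by have := congr1 (@projT1 _ _) e.
rewrite -ei mul1r (bigD1 (upd b i x)) /=; last by rewrite upd_same.
rewrite upd_same eqxx mul1r big1 ?addr0 // => a /andP[/eqP ax nax].
by rewrite ax eq_sym (negPf nax) mul0r.
Qed.

(** Write beta for #|S i0|, the rank of the flattening in direction i0. The
index set U is phi itself (None) and its derivatives along the columns b i t
(Some); it has 1 + sum m_i #|S i| elements, more than the set E of the far
points in the slices of S i0. So a nontrivial combination tau of these
functions satisfies one linear condition for each point of E: it vanishes
there, except that at the pivot of (x, z) the condition is instead that the
corresponding combination mu of the derivatives of lambda(x, z) vanishes. It is
shown that tau = 0, and then that the combination was trivial. *)
Lemma generic_vectors_span a : phi a = 0.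
Proof.
have [//|nda0] := boolP (near_diag a); first exact: phi_diag.
apply/eqP/negPn/negP => phia_neq0.
have flat i := rank_factorization (fun (x : 'I_r) (b : point) => phi (upd b i x)).
have [S /dependent_choice_fun[b b_spec]] := dependent_choice_fun flat.
have b_free i : forall c : 'I_#|S i| -> F,
       (forall x, \sum_t c t * phi (upd (b i t) i x) = 0) -> forall t, c t = 0.
  by case: (b_spec i) => lam [_].
pose j0 : 'I_k := Ordinal (ltn_trans (isT : (0 < 2)%N) k_ge3).
pose i0 : 'I_k := [arg min_(i < j0) #|S i|].
have S_min i : (#|S i0| <= #|S i|)%N.
  by rewrite /i0; case: arg_minnP => // i' _; apply.
have [lam [span _]] := b_spec i0.
have [i1] : exists i1, i1 \notin [:: i0] by apply: avoid_seq; apply: leq_trans k_ge3.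
rewrite inE => i10.
have [i2] : exists i2, i2 \notin [:: i0; i1] by apply: avoid_seq.
rewrite !inE negb_or => /andP[i20 i21].
(* For x in the row basis the slice x needs no relation, hence the empty support. *)
pose supp x : {set 'I_r} := [set z in S i0 | (x \notin S i0) && (lam x z != 0)].
have suppN x : x \notin supp x.
  by rewrite inE; case: (x \in S i0).
have pivots x := pivots_exist k_ge3 i10 nda0 (suppN x).
have [y /dependent_choice_fun[p yp_spec]] := dependent_choice_fun pivots.
have y_inj x : {in supp x &, injective (y x)} by have [] := yp_spec x.
have yp x z : z \in supp x ->
      [/\ y x z != x, p x z \in supp x & ~~ near_diag (corner i0 i1 (p x z) (y x z) x)].
  by have [_] := yp_spec x; apply.
pose pivot q := corner i0 i1 (p q.1 q.2) (y q.1 q.2) q.1.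
pose U : finType := option {i : 'I_k & ('I_(m i) * 'I_#|S i|)%type}.
pose E : finType := {e : point | e \in [set e : point | ~~ near_diag e & e i0 \in S i0]}.
have cardE : #|E| = (#|S i0| * \sum_i m i)%N.
  transitivity #|[set e : point | ~~ near_diag e & e i0 \in S i0]|.
    by rewrite card_sig; apply: eq_card => e; rewrite !inE.
  rewrite -sum1dep_card (partition_big (fun e : point => e i0) (mem (S i0))) /=.
    rewrite -sum_nat_const; apply: eq_bigr => x Sx.
    rewrite -(@card_far_slice i0 x) -sum1dep_card; apply: eq_bigl => e.
    have [ex|] := eqVneq (e i0) x; last by rewrite !andbF.
    have -> : e i0 \in S i0 by rewrite ex.
    by rewrite !andbT.
  by move=> e /andP[].
have cardU : (#|E| < #|U|)%N.
  rewrite cardE card_option card_tagged sumnE big_map big_enum /= ltnS big_distrr /=.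
  by apply: leq_sum => i _; rewrite card_prod !card_ord mulnC leq_mul2l S_min orbT.
pose Du (u : U) : F -> F := if u is Some (existT i (j, t)) then D j (b i t) else id.
pose is_pivot e := [pick q : 'I_r * 'I_r | (q.2 \in supp q.1) && (e == pivot q)].
pose Eq (e : E) (u : U) : F :=
  if is_pivot (val e) is Some q then
    (if u is Some _ then Du u (lam q.1 q.2) else 0) else Du u (phi (val e)).
have [c [u0 cu0] ceq] := underdetermined_system Eq cardU.
pose Dl (u : U) (x : F) : F := if u is Some _ then Du u x else 0.
pose tau a := \sum_u Du u (phi a) * c u.
pose mu x z := \sum_u Dl u (lam x z) * c u.
(* Leibniz rule for the relation between the slice x and the slices of the basis. *)
have tau_rule x a' : tau (upd a' i0 x) =
    \sum_(z in S i0) (mu x z * phi (upd a' i0 z) + lam x z * tau (upd a' i0 z)).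
  have Du_rule u : Du u (phi (upd a' i0 x)) =
      \sum_(z in S i0) (Dl u (lam x z) * phi (upd a' i0 z)
                        + lam x z * Du u (phi (upd a' i0 z))).
    rewrite span; case: u => [[i [j t]]|] /=.
      by rewrite D_sum; apply: eq_bigr => z _; rewrite DM.
    by apply: eq_bigr => z _; rewrite mul0r add0r.
  rewrite {1}/tau; under eq_bigr => u _ do rewrite Du_rule mulr_suml.
  rewrite exchange_big /=; apply: eq_bigr => z _.
  rewrite /mu /tau mulr_suml mulr_sumr -big_split /=; apply: eq_bigr => u _.
  by rewrite mulrDl mulrAC mulrA.
have tau_diag e : near_diag e -> tau e = 0.
  move=> nde; rewrite /tau big1 // => u _; rewrite phi_diag //.
  by case: u => [[i [j t]]|] /=; rewrite ?D0 mul0r.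
(* Two pivots on the same line of direction i0 are equal: this line determines x,
   by a coordinate i2 other than i0 and i1, and then y x z, hence z. *)
have pivot_inj q q' : q.2 \in supp q.1 -> q'.2 \in supp q'.1 ->
    forall z, pivot q' = upd (pivot q) i0 z -> q' = q.
  case: q q' => [x z] [x' z'] /= zx zx' u; rewrite upd_corner => epiv.
  have ex : x' = x.
    have := congr1 (fun e : point => e i2) epiv.
    by rewrite !corner2.
  have ey : y x z' = y x z.
    have := congr1 (fun e : point => e i1) epiv.
    by rewrite !corner1 // ex.
  by rewrite ex in zx' *; rewrite (y_inj x z' z).
have tau_nonpivot (e : point) : ~~ near_diag e -> e i0 \in S i0 ->
    is_pivot e = None -> tau e = 0.
  move=> nde eS piv; have eE : e \in [set e : point | ~~ near_diag e & e i0 \in S i0].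
    by rewrite inE nde.
  by rewrite -[RHS](ceq (exist _ e eE : E)) /Eq /= piv.
have pivotE x z : z \in supp x -> is_pivot (pivot (x, z)) = Some (x, z).
  move=> zx; rewrite /is_pivot; case: pickP => [q /andP[q2 /eqP epiv]|/(_ (x, z))].
    congr Some; apply: (pivot_inj (x, z) q zx q2 (pivot (x, z) i0)).
    by rewrite upd_id epiv.
  by rewrite /= zx eqxx.
have supp_S x z : z \in supp x -> z \in S i0 by rewrite inE => /andP[].
have mu0 x z : x \notin S i0 -> z \in S i0 -> mu x z = 0.
  move=> xS zS; have [zx|] := boolP (z \in supp x).
    have [_ ps nde] := yp x z zx.
    have eE : pivot (x, z) \in [set e : point | ~~ near_diag e & e i0 \in S i0].
      by rewrite inE nde /= /pivot corner0 (supp_S x).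
    rewrite -[RHS](ceq (exist _ (pivot (x, z)) eE : E)) /Eq /= pivotE //.
  rewrite inE zS xS /= negbK => /eqP lam0.
  rewrite /mu big1 // => u _; rewrite lam0.
  by case: u => [[i [j t]]|] /=; rewrite ?D0 mul0r.
(* At the pivot e of (x, z), use the rule at the near-diagonal point of the same
   line, where tau vanishes: all terms but lambda(x, p x z) * tau e are zero, as
   the other points of the line are near-diagonal or nonpivots. *)
have tau_S (e : point) : e i0 \in S i0 -> tau e = 0.
  move=> eS; have [nde|nde] := boolP (near_diag e); first exact: tau_diag.
  case piv : (is_pivot e) => [[x z]|]; last exact: tau_nonpivot.
  move: piv; rewrite /is_pivot; case: pickP => // q /andP[q2 /eqP epiv] [eq].
  rewrite {q}eq /= in q2 epiv.
  have [yx ps nde'] := yp x z q2.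
  have xS : x \notin S i0 by move: q2; rewrite inE => /and3P[].
  have := tau_rule x e; rewrite epiv upd_corner tau_diag; last exact: near_diag_corner.
  rewrite (bigD1 (p x z)) /=; last exact: supp_S ps.
  rewrite mu0 // ?(supp_S x) // mul0r add0r upd_corner big1 => [|z' /andP[Sz' nz']].
    rewrite addr0 => /esym/eqP; rewrite mulf_eq0 => /orP[/eqP lam0|/eqP->//].
    by move: ps; rewrite inE xS lam0 eqxx !andbF.
  rewrite mu0 // mul0r add0r upd_corner.
  have [->|lam_neq0] := eqVneq (lam x z') 0; first by rewrite mul0r.
  have [nd'|nd'] := boolP (near_diag (corner i0 i1 z' (y x z) x)).
    by rewrite tau_diag // mulr0.
  rewrite tau_nonpivot ?mulr0 // ?corner0 // /is_pivot.
  case: pickP => // q /andP[qs /eqP eq]; exfalso.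
  have := pivot_inj (x, z) q q2 qs z'; rewrite upd_corner => /(_ (esym eq)) eqq.
  move: eq; rewrite eqq /pivot /= => /(congr1 (fun e : point => e i0)).
  by rewrite !corner0 => /eqP; rewrite (negPf nz').
have tau0 e : tau e = 0.
  have [eS|eS] := boolP (e i0 \in S i0); first exact: tau_S.
  rewrite -(upd_id e i0) tau_rule big1 // => z Sz.
  by rewrite mu0 // tau_S ?upd_same // mulr0 mul0r addr0.
(* Contracting tau = 0 with w_(i,j) keeps the derivatives along w_(i,j) only, and
   leaves a relation between the columns b i t of the flattening of phi. *)
have c_Some i (j : 'I_(m i)) t :
    c (Some (Tagged (fun i => ('I_(m i) * 'I_#|S i|)%type) (j, t))) = 0.
  apply: (b_free i (fun t =>
    c (Some (Tagged (fun i => ('I_(m i) * 'I_#|S i|)%type) (j, t))))) => x.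
  have : \sum_(e : point | e i == x) w j e * tau e = 0.
    by rewrite big1 // => e _; rewrite tau0 mulr0.
  under eq_bigr => e _ do rewrite /tau mulr_sumr.
  rewrite exchange_big /=.
  under eq_bigr => u _ do under eq_bigr => e _ do rewrite mulrA.
  under eq_bigr => u _ do rewrite -mulr_suml.
  pose h t' : U := Some (Tagged (fun i => ('I_(m i) * 'I_#|S i|)%type) (j, t')).
  have h_inj : injective h.
    move=> t1 t2 /(congr1 (fun u : U => if u is Some (existT i' (j', t')) then
      val t' else 0%N)) /= et; exact: val_inj.
  rewrite (bigID (fun u => u \in [set h t' | t' in 'I_#|S i|])) /=.
  rewrite [X in _ + X]big1 => [|[[i' [j' t']]|] nh].
  - rewrite addr0 big_imset /=; last by move=> t1 t2 _ _; apply: h_inj.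
    under eq_bigr => t' _ do rewrite contract_D eqxx mul1r mulNr mulrC.
    by rewrite sumrN => /eqP; rewrite oppr_eq0 => /eqP.
  - rewrite /= contract_D; case: eqP => [e|]; last by rewrite mul0r oppr0 mul0r.
    case/negP: nh; have ei : i' = i by have := congr1 (@projT1 _ _) e.
    subst i'; move/eqP: e; rewrite eq_Tagged /= => /eqP ->.
    by apply/imsetP; exists t'.
  by rewrite phi_w mul0r.
move: u0 cu0 => [[i [j t]]|]; first by rewrite c_Some eqxx.
move/negP; apply; apply/eqP.
have := tau0 a; rewrite /tau (bigD1 None) //= big1 ?addr0 => [|[[i [j t]]|] //= _].
  by move=> /eqP; rewrite mulf_eq0 (negPf phia_neq0) => /eqP.
by rewrite c_Some mulr0.
Qed.
End GenericVectors.

(** * Derivations of fraction fields *)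

Section FractionRepresentation.
Local Open Scope quotient_scope.

Lemma fraction_repr (R : idomainType) (x : {fraction R}) :
  exists ab : R * R, ab.2 != 0 /\ x = tofrac ab.1 / tofrac ab.2.
Proof.
elim/quotW: x => x; exists (frac x); split; first exact: denom_ratioP.
rewrite -{1}[x]FracField.Ratio_numden.
change (\pi_(FracField.type R) (Ratio (frac x).1 (frac x).2) =
  FracField.mul (FracField.tofrac (frac x).1) (FracField.inv (FracField.tofrac (frac x).2))).
rewrite !piE /FracField.invf /FracField.mulf /=.
by rewrite !numden_Ratio ?oner_neq0 ?denom_ratioP // mul1r mulr1.
Qed.

End FractionRepresentation.

(** The quotient rule does not depend on the fraction and gives a derivation;
these identities are stated for arbitrary field elements da, db in place of the
derivatives of a and b. *)
Section QuotientRule.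
Variable F : fieldType.
Implicit Types a b : F.

Lemma quotient_rule_wd a b a' b' da db da' db' : b != 0 -> b' != 0 ->
  a' * b = a * b' -> da' * b + a' * db = da * b' + a * db' ->
  (da' * b' - a' * db') / b' ^+ 2 = (da * b - a * db) / b ^+ 2.
Proof.
move=> b0 b0' cross dcross.
have a_def : a' = a * b' / b by rewrite -cross mulfK.
have da_def : da' = (da * b' + a * db' - a' * db) / b by rewrite -dcross addrK mulfK.
by rewrite da_def a_def; field; rewrite b0 b0'.
Qed.

Lemma quotient_ruleD a b a' b' da db da' db' : b != 0 -> b' != 0 ->
  ((da * b' + a * db' + (da' * b + a' * db)) * (b * b')
    - (a * b' + a' * b) * (db * b' + b * db')) / (b * b') ^+ 2 =
  (da * b - a * db) / b ^+ 2 + (da' * b' - a' * db') / b' ^+ 2.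
Proof. by move=> b0 b0'; field; rewrite b0 b0'. Qed.

Lemma quotient_ruleM a b a' b' da db da' db' : b != 0 -> b' != 0 ->
  ((da * a' + a * da') * (b * b') - (a * a') * (db * b' + b * db')) / (b * b') ^+ 2 =
  (da * b - a * db) / b ^+ 2 * (a' / b') + a / b * ((da' * b' - a' * db') / b' ^+ 2).
Proof. by move=> b0 b0'; field; rewrite b0 b0'. Qed.

End QuotientRule.

Section FractionDerivation.
Variables (R : idomainType) (d : R -> R).
Hypothesis dD : {morph d : x y / x + y}.
Hypothesis dM : forall x y, d (x * y) = d x * y + x * d y.
Notation "x %:F" := (tofrac x).

Definition fraction_derivation (x : {fraction R}) : {fraction R} :=
  let ab := projT1 (cid (fraction_repr x)) in
  ((d ab.1)%:F * ab.2%:F - ab.1%:F * (d ab.2)%:F) / ab.2%:F ^+ 2.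
Notation D := fraction_derivation.

Lemma fraction_derivationE a b : b != 0 ->
  D (a%:F / b%:F) = ((d a)%:F * b%:F - a%:F * (d b)%:F) / b%:F ^+ 2.
Proof.
move=> b0; rewrite /D; case: cid => -[n m] /= [m0 e].
have bF : b%:F != 0 by rewrite tofrac_eq0.
have mF : m%:F != 0 by rewrite tofrac_eq0.
have cross : n * b = a * m.
  by apply/eqP; rewrite -tofrac_eq !tofracM -eqr_div // -e.
apply: quotient_rule_wd => //; first by rewrite -!tofracM cross.
by rewrite -!tofracM -!tofracD -!dM cross.
Qed.

Lemma fraction_derivation_tofrac a : D a%:F = (d a)%:F.
Proof.
have d1 : d 1 = 0.
  by apply: (addrI (d 1)); have := dM 1 1; rewrite !mulr1 mul1r addr0 => <-.
rewrite -[a%:F]divr1 -tofrac1 fraction_derivationE ?oner_eq0 //.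
by rewrite d1 tofrac0 mulr0 subr0 tofrac1 expr1n divr1 mulr1.
Qed.

Lemma fraction_derivationD : {morph D : x y / x + y}.
Proof.
move=> x y; have [[a b] /= [b0 ->]] := fraction_repr x.
have [[a' b'] /= [b0' ->]] := fraction_repr y.
rewrite addf_div ?tofrac_eq0 // -!tofracM -tofracD !fraction_derivationE ?mulf_neq0 //.
by rewrite dD !dM !(tofracD, tofracM) quotient_ruleD ?tofrac_eq0.
Qed.

Lemma fraction_derivationM x y : D (x * y) = D x * y + x * D y.
Proof.
have [[a b] /= [b0 ->]] := fraction_repr x.
have [[a' b'] /= [b0' ->]] := fraction_repr y.
rewrite mulf_div -!tofracM !fraction_derivationE ?mulf_neq0 //.
by rewrite !dM !(tofracD, tofracM) quotient_ruleM ?tofrac_eq0.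
Qed.

End FractionDerivation.

(** * Nonvanishing of polynomials in characteristic 0 *)

Lemma mderiv_var (K : fieldType) n (i j : 'I_n) :
  mderiv i ('X_j : {mpoly K[n]}) = (j == i)%:R.
Proof.
rewrite mderivX mnm1E; case: eqP => [->|_]; last by rewrite scale0r.
suff -> : (U_(i) - U_(i) = 0)%MM by rewrite mpolyX0 scale1r.
by apply/mnmP => t; rewrite mnmBE mnm0E subnn.
Qed.

Section Nonvanishing.
Variables (K : fieldType) (charK : [pchar K] =i pred0).

Lemma pchar0_natr_inj : injective (fun i : nat => i%:R : K).
Proof.
have /pcharf0P nat0 := charK.
move=> i j /eqP; wlog le_ij : i j / (i <= j)%N => [wl|].
  by have [/wl//|/ltnW/wl] := leqP i j; rewrite eq_sym => H /H.
by rewrite eq_sym -subr_eq0 -natrB // nat0 subn_eq0 => le_ji; apply/eqP; rewrite eqn_leq le_ij.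
Qed.

Lemma poly_nonvanishing (p : {poly K}) : p != 0 -> exists x, p.[x] != 0.
Proof.
move=> p0; pose s := [seq i%:R : K | i <- iota 0 (size p)].
have us : uniq s by rewrite map_inj_uniq ?iota_uniq //; exact: pchar0_natr_inj.
have [/allP roots|/allPn[x _ nroot]] := boolP (all (root p) s); last by exists x.
have := max_poly_roots p0 (introT allP roots) us.
by rewrite size_map size_iota ltnn.
Qed.

Lemma widen_lift n (i : 'I_n) : widen_ord (leqnSn n) i = lift ord_max i.
Proof. by apply: val_inj; rewrite [RHS]lift_max. Qed.

(** A polynomial in n + 1 variables is a polynomial in the last one, whose
coefficients are polynomials in the others. *)
Lemma meval_muni n (p : {mpoly K[n.+1]}) (v : 'I_n.+1 -> K) :
    p.@[v] = (map_poly (meval (fun i => v (widen_ord (leqnSn n) i))) (muni p)).[v ord_max].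
Proof.
rewrite muniE mevalE raddf_sum horner_sum; apply: eq_bigr => m _ /=.
rewrite map_polyZ map_polyXn hornerZ hornerXn /= mevalZ mevalX big_ord_recr /= mulrA.
congr (_ * _ * _).
by apply: eq_bigr => i _; rewrite mnmE.
Qed.

Lemma mpoly_nonvanishing n (p : {mpoly K[n]}) : p != 0 -> exists v, p.@[v] != 0.
Proof.
elim: n p => [|n IHn] p p0.
  exists (fun=> 0); move: p0; rewrite [p]nvar0_mpolyC mevalC.
  by apply: contraNneq => ->.
have [m pm] : exists m, p@_m != 0.
  exists (mlead p); apply: contraNneq p0; rewrite -/(mleadc p) => /eqP.
  by rewrite mleadc_eq0.
pose q := (muni p)`_(m ord_max).
have q0 : q != 0.
  pose m' := [multinom m (widen_ord (leqnSn n) i) | i < n].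
  suff : q@_m' = p@_m by apply: contra_eq_neq => ->; rewrite mcoeff0 eq_sym.
  rewrite /q muniE coef_sum raddf_sum /=.
  have mE m1 : (m1 == m) = ([multinom m1 (widen_ord (leqnSn n) i) | i < n] == m')
                           && (m1 ord_max == m ord_max).
    apply/eqP/andP => [->|[/eqP e1 /eqP e2]]; first by rewrite !eqxx.
    apply/mnmP => i; case: (unliftP ord_max i) => [j ->|-> //].
    have := congr1 (fun m : 'X_{1..n} => m j) e1; rewrite !mnmE.
    by rewrite widen_lift.
  have summand m1 : ((p@_m1 *: 'X_[[multinom m1 (widen_ord (leqnSn n) i) | i < n]]
      *: 'X^(m1 ord_max))`_(m ord_max))@_m' = (m1 == m)%:R * p@_m1.
    rewrite coefZ coefXn mE [m1 ord_max == _]eq_sym; case: (m ord_max == m1 ord_max).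
      by rewrite mulr1 mcoeffZ mcoeffX andbT mulrC.
    by rewrite mulr0 mcoeff0 andbF mul0r.
  under eq_bigr => m1 _ do rewrite summand.
  rewrite (bigD1_seq m) /= ?msupp_uniq ?mcoeff_neq0 //; last by rewrite mcoeff_msupp.
  by rewrite eqxx mul1r big1 ?addr0 // => m1 /negPf ->; rewrite mul0r.
have [v qv] := IHn _ q0.
have : map_poly (meval v) (muni p) != 0.
  apply: contra_eq_neq (coef_map (meval v) (muni p) (m ord_max)) => ->.
  by rewrite coef0 eq_sym.
case/poly_nonvanishing=> x px.
exists (fun i => if unlift ord_max i is Some j then v j else x).
rewrite meval_muni unlift_none; apply: contraNneq px => <-; apply/eqP; congr (_.[_]).
congr (map_poly _ _); apply/funext => q'; apply: meval_eq => i.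
by rewrite widen_lift liftK.
Qed.

End Nonvanishing.

(** * Vectors of maximal rank over the base field *)

Section IndependentLines.
Variables (K : fieldType) (charK : [pchar K] =i pred0).
Variables (k r : nat) (k_ge3 : (3 <= k)%N) (x0 : 'I_r).
Notation point := (midx (fun _ : 'I_k => r)).
Variable m : 'I_k -> nat.
Hypothesis count : (r * \sum_i m i = #|[set a : point | ~~ near_diag a]|)%N.

(** The indeterminate w_(i,j)(b) depends on the line of direction i through b;
lines are indexed by their points whose i-th coordinate is x0. *)
Let V : finType := {i : 'I_k & ('I_(m i) * point)%type}.
Let R := {mpoly K[#|V|]}.
Let var i (j : 'I_(m i)) (b : point) : V :=
  Tagged (fun i => ('I_(m i) * point)%type) (j, upd b i x0).
Let X i (j : 'I_(m i)) (b : point) : R := 'X_(enum_rank (var j b)).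

Let rows : finType := {i : 'I_k & ('I_(m i) * 'I_r)%type}.
Let far : {set point} := [set a | ~~ near_diag a].
Let pt (t : 'I_#|far|) : point := enum_val t.

Let pt_far t : ~~ near_diag (pt t).
Proof. by have := enum_valP t; rewrite inE. Qed.

Let pt_surj (a : point) : ~~ near_diag a -> exists t, pt t = a.
Proof.
move=> nda; have aG : a \in far by rewrite inE.
by exists (enum_rank_in aG a); rewrite /pt enum_rankK_in.
Qed.

Let card_rows : #|rows| = #|far|.
Proof.
rewrite card_tagged sumnE big_map big_enum /= -count big_distrr /=.
by apply: eq_bigr => i _; rewrite card_prod !card_ord mulnC.
Qed.

Let row_of (s : 'I_#|far|) : rows := enum_val (cast_ord (esym card_rows) s).
Let rank_of i (j : 'I_(m i)) (x : 'I_r) : 'I_#|far| :=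
  cast_ord card_rows (enum_rank (Tagged (fun i => ('I_(m i) * 'I_r)%type) (j, x))).

Let rank_ofK i (j : 'I_(m i)) x :
  row_of (rank_of j x) = Tagged (fun i => ('I_(m i) * 'I_r)%type) (j, x).
Proof. by rewrite /row_of cast_ordK enum_rankK. Qed.

Let sum_rows (S : nmodType) (f : rows -> S) :
  \sum_s f (row_of s) =
  \sum_i \sum_(j < m i) \sum_x f (Tagged (fun i => ('I_(m i) * 'I_r)%type) (j, x)).
Proof.
transitivity (\sum_q f q).
  rewrite (reindex row_of) //=; apply: onW_bij.
  exists (fun q => cast_ord card_rows (enum_rank q)) => [s|q].
    by rewrite /row_of enum_valK cast_ordKV.
  by rewrite /row_of cast_ordK enum_rankK.
under [RHS]eq_bigr => i _ do rewrite pair_bigA /=.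
rewrite sig_big_dep /=.
by apply: eq_bigr => -[i [j x]].
Qed.

(** The square matrix of the pairing of the unknowns kappa_(i,j)(x) with the far
points. *)
Let sys (S : nzRingType) (w : forall i, 'I_(m i) -> point -> S) : 'M[S]_#|far| :=
  \matrix_(s, t) let: existT i (j, x) := row_of s in
    if pt t i == x then w i j (pt t) else 0.

Let sys_col (S : comNzRingType) (w : forall i, 'I_(m i) -> point -> S) (phi : point -> S) :
  (forall a, near_diag a -> phi a = 0) ->
  (forall i (j : 'I_(m i)) x, \sum_(a : point | a i == x) w i j a * phi a = 0) <->
  sys w *m (\col_t phi (pt t)) = 0.
Proof.
move=> phi_diag.
have sumE (i : 'I_k) (j : 'I_(m i)) (x : 'I_r) :
    \sum_(a : point | a i == x) w i j a * phi a =
    \sum_t (if pt t i == x then w i j (pt t) else 0) * phi (pt t).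
  rewrite -(big_enum_val (A := mem far)
    (fun a : point => (if a i == x then w i j a else 0) * phi a)).
  rewrite [LHS](bigID (fun a => near_diag a)) /= [X in X + _]big1 ?add0r; last first.
    by move=> a /andP[_ nda]; rewrite phi_diag ?mulr0.
  rewrite big_mkcond [RHS]big_mkcond; apply: eq_bigr => a _; rewrite !inE.
  by case: (near_diag a); case: (a i == x); rewrite ?mul0r.
split=> [phi_w|sys0 i j x].
  apply/colP => s; rewrite !mxE.
  case E : (row_of s) => [i [j x]].
  by rewrite -[RHS](phi_w i j x) sumE; apply: eq_bigr => t _; rewrite !mxE E.
rewrite sumE.
have := congr1 (fun u : 'cV_ _ => u (rank_of j x) 0) sys0.
rewrite !mxE => s0; rewrite -[RHS]s0.
by apply: eq_bigr => t _; rewrite !mxE rank_ofK.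
Qed.

(** The determinant of the system is nonzero for indeterminate entries, since
its columns are independent over the fraction field by [generic_vectors_span];
so it is nonzero for some values in K. *)
Lemma exists_independent_lines :
  exists W : forall i, 'I_(m i) -> point -> K,
  [/\ forall i (j : 'I_(m i)) a x, W i j (upd a i x) = W i j a,
      forall phi : point -> K, (forall a, near_diag a -> phi a = 0) ->
        (forall i (j : 'I_(m i)) x, \sum_(a : point | a i == x) W i j a * phi a = 0) ->
        forall a, phi a = 0 &
      forall kappa : forall i, 'I_(m i) -> 'I_r -> K,
        (forall a : point, ~~ near_diag a ->
           \sum_i \sum_j kappa i j (a i) * W i j a = 0) ->
        forall i j x, kappa i j x = 0].
Proof.
have det0 : \det (sys X) != 0.
  apply/negP => /eqP detX.
  have : \det (sys (fun i j b => tofrac (X j b)))^T == 0.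
    rewrite det_tr.
    have -> : sys (fun i (j : 'I_(m i)) b => tofrac (X j b)) = map_mx (@tofrac _) (sys X).
      apply/matrixP => s t; rewrite !mxE; case: (row_of s) => i [j x] /=.
      by case: ifP; rewrite ?tofrac0.
    by rewrite det_map_mx /= detX tofrac0.
  case/det0P => v v0 vM.
  suff vT0 : v^T = 0 by rewrite -(trmxK v) vT0 trmx0 eqxx in v0.
  pose phi (a : point) := \sum_(t | pt t == a) v 0 t.
  have vE : v^T = \col_t phi (pt t).
    apply/colP => t; rewrite !mxE /phi (big_pred1 t) // => t'.
    by rewrite /= /pt (inj_eq enum_val_inj).
  have phi_diag a : near_diag a -> phi a = 0.
    move=> nda; rewrite /phi big1 // => t /eqP et.
    by have := pt_far t; rewrite et nda.
  have := congr1 trmx vM; rewrite trmx_mul trmxK trmx0 vE => /(sys_col _ phi_diag) phi_w.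
  apply/colP => t; rewrite !mxE.
  pose D i (j : 'I_(m i)) b := @fraction_derivation R (mderiv (enum_rank (var j b))).
  apply: (@generic_vectors_span k r _ k_ge3 (leq_ltn_trans (leq0n x0) (ltn_ord x0)) m _ D
           _ _ _ count phi phi_diag phi_w).
  - by move=> i j b; apply: fraction_derivationD; [apply: mderivD | apply: mderivM].
  - by move=> i j b; apply: fraction_derivationM; apply: mderivM.
  move=> i j b i' j' a; rewrite /D fraction_derivation_tofrac; last exact: mderivM.
  have -> : mderiv (enum_rank (var j b)) (X j' a) = (var j' a == var j b)%:R.
    by rewrite mderiv_var (inj_eq enum_rank_inj).
  rewrite rmorph_nat; congr (nat_of_bool _)%:R.
  rewrite -!tag_eqE /tag_eq /= [i' == i]eq_sym; case: (eqVneq i i') => //= e.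
  subst i'; rewrite !tagged_asE /var /= xpair_eqE [j' == j]eq_sym; congr (_ && _).
  apply/eqP/eqP => [e|<-]; last by rewrite upd_upd.
  by rewrite -[in RHS](upd_id a i) -(upd_upd a x0) e upd_upd.
have [p dp] := mpoly_nonvanishing charK det0.
pose W i (j : 'I_(m i)) b := (X j b).@[p].
have unitW : sys W \in unitmx.
  rewrite unitmxE unitfE.
  have -> : sys W = map_mx (meval p) (sys X).
    apply/matrixP => s t; rewrite !mxE; case: (row_of s) => i [j x] /=.
    by case: ifP; rewrite ?meval0.
  by rewrite det_map_mx.
exists W; split.
- by move=> i j a x; rewrite /W /X /var upd_upd.
- move=> phi phi_diag /(sys_col _ phi_diag) phi_w a.
  have [/phi_diag//|nda] := boolP (near_diag a).
  have : \col_t phi (pt t) = 0 by rewrite -[LHS](mulKmx unitW) phi_w mulmx0.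
  by have [t <-] := pt_surj nda; move/colP/(_ t); rewrite !mxE.
move=> kappa kW i j x.
pose u : 'rV_#|far| := \row_s let: existT i (j, x) := row_of s in kappa i j x.
have u0 : u = 0.
  rewrite -[LHS](mulmxK unitW); suff -> : u *m sys W = 0 by rewrite mul0mx.
  apply/rowP => t; rewrite !mxE -[RHS](kW _ (pt_far t)).
  under eq_bigr => s _ do rewrite !mxE.
  rewrite (sum_rows (fun q => (let: existT i (j, x) := q in kappa i j x) *
     (let: existT i (j, x) := q in if pt t i == x then W i j (pt t) else 0))) /=.
  apply: eq_bigr => i' _; apply: eq_bigr => j' _.
  rewrite (bigD1 (pt t i')) //= eqxx big1 ?addr0 // => x' /negPf nx.
  by rewrite eq_sym nx mulr0.
by move/rowP: u0 => /(_ (rank_of j x)); rewrite !mxE rank_ofK.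
Qed.

End IndependentLines.

(** * Substitution, algebraic dependence and Jacobians *)

(** Substitution of polynomials for the variables. *)
Notation msubst h := (mmap (@mpolyC _ _) h).

Lemma left_inverse_of_injective (F : fieldType) (I J : finType) (A : I -> J -> F) :
  (forall phi : J -> F, (forall i, \sum_j A i j * phi j = 0) -> forall j, phi j = 0) ->
  exists L : J -> I -> F, forall j j', \sum_i L j i * A i j' = (j == j')%:R.
Proof.
move=> injA; pose M := \matrix_(j < #|J|, i < #|I|) A (enum_val i) (enum_val j).
have freeM : row_free M.
  rewrite -kermx_eq0; apply/eqP/row_matrixP => s; rewrite row0.
  have : row s (kermx M) *m M = 0 by rewrite -row_mul mulmx_ker row0.
  move: (row s _) => v vM; apply/rowP => t; rewrite mxE -(enum_valK t).
  apply: (injA (fun j => v 0 (enum_rank j))) => i.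
  have := congr1 (fun u : 'rV_ _ => u 0 (enum_rank i)) vM; rewrite !mxE => vMi.
  rewrite -[RHS]vMi [RHS](reindex enum_rank) /=; last by apply: onW_bij; apply: enum_rank_bij.
  by apply: eq_bigr => j _; rewrite mxE !enum_rankK mulrC.
exists (fun j i => pinvmx M (enum_rank i) (enum_rank j)) => j j'.
have := congr1 (fun B : 'M_ _ => B (enum_rank j') (enum_rank j)) (mulmxVp freeM).
rewrite !mxE (inj_eq enum_rank_inj) eq_sym => e; rewrite -[RHS]e.
rewrite [RHS](reindex enum_rank) /=; last by apply: onW_bij; apply: enum_rank_bij.
by apply: eq_bigr => i _; rewrite [M _ _]mxE !enum_rankK mulrC.
Qed.

Lemma mpoly_ring_ind n (R : comNzRingType) (P : {mpoly R[n]} -> Prop) :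
  (forall c, P c%:MP) -> (forall i, P 'X_i) ->
  (forall p q, P p -> P q -> P (p + q)) -> (forall p q, P p -> P q -> P (p * q)) ->
  forall p, P p.
Proof.
move=> PC PX PD PM p.
have P1 : P 1 by rewrite -mpolyC1.
have P0 : P 0 by rewrite -mpolyC0.
rewrite [p]mpolyE; apply: (big_ind P P0 PD) => m _; rewrite -mul_mpolyC; apply: (PM) => //.
rewrite mpolyXE_id; apply: (big_ind P P1 PM) => i _.
by elim: (m i) => [|e IHe]; rewrite ?expr0 // exprS; apply: PM.
Qed.

Section Substitution.
Variables (K : fieldType) (charK : [pchar K] =i pred0).

Lemma mpoly_ext n (p q : {mpoly K[n]}) : (forall v, p.@[v] = q.@[v]) -> p = q.
Proof.
move=> pq; apply/eqP; rewrite -subr_eq0; apply/negPn/negP.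
by case/(mpoly_nonvanishing charK) => v; rewrite mevalB pq subrr eqxx.
Qed.

Lemma mcoeff_bigsum n (I : Type) (s : seq I) (P : pred I) (f : I -> {mpoly K[n]}) m :
  (\sum_(i <- s | P i) f i)@_m = \sum_(i <- s | P i) (f i)@_m.
Proof. exact: raddf_sum. Qed.

Lemma msubst_sum n m (h : 'I_n -> {mpoly K[m]}) (I : Type) (s : seq I) (P : pred I)
    (f : I -> {mpoly K[n]}) :
  msubst h (\sum_(i <- s | P i) f i) = \sum_(i <- s | P i) msubst h (f i).
Proof. exact: raddf_sum. Qed.

Lemma meval_msubst n m (h : 'I_n -> {mpoly K[m]}) g v :
  (msubst h g).@[v] = g.@[fun i => (h i).@[v]].
Proof.
elim/mpoly_ring_ind: g => [c|i|p q Ep Eq|p q Ep Eq].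
- by rewrite mmapC !mevalC.
- by rewrite mmapX mmap1U mevalXU.
- by rewrite mmapD !mevalD Ep Eq.
- by rewrite rmorphM !mevalM Ep Eq.
Qed.

Lemma msubst_msubst n m l (h : 'I_n -> {mpoly K[m]}) (h' : 'I_m -> {mpoly K[l]}) g :
  msubst h' (msubst h g) = msubst (fun i => msubst h' (h i)) g.
Proof.
apply: mpoly_ext => v; rewrite !meval_msubst; apply: meval_eq => i.
by rewrite meval_msubst.
Qed.

(** The chain rule. *)
Lemma mderiv_msubst n m (h : 'I_n -> {mpoly K[m]}) s g :
  mderiv s (msubst h g) = \sum_i msubst h (mderiv i g) * mderiv s (h i).
Proof.
elim/mpoly_ring_ind: g => [c|j|p q Ep Eq|p q Ep Eq].
- rewrite mmapC mderivC big1 // => i _.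
  by rewrite mderivC mmap0 mul0r.
- rewrite mmapX mmap1U (bigD1 j) //= big1 => [|i ij].
    by rewrite mderiv_var eqxx rmorph1 mul1r addr0.
  by rewrite mderiv_var eq_sym (negPf ij) mmap0 mul0r.
- rewrite mmapD mderivD Ep Eq -big_split; apply: eq_bigr => i _.
  by rewrite mderivD mmapD mulrDl.
- rewrite rmorphM mderivM Ep Eq mulr_suml mulr_sumr -big_split; apply: eq_bigr => i _.
  rewrite mderivM mmapD !rmorphM /= mulrDl; congr (_ + _); last by rewrite mulrA.
  by rewrite mulrAC.
Qed.

Lemma msize_prod_bound n (I : finType) (h : I -> {mpoly K[n]}) (alpha : I -> nat) b :
  (forall i, msize (h i) <= b.+1)%N ->
  (msize (\prod_i h i ^+ alpha i) <= (\sum_i alpha i * b).+1)%N.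
Proof.
move=> hb.
have mul_bound p q u v : (msize (p : {mpoly K[n]}) <= u.+1 -> msize (q : {mpoly K[n]}) <= v.+1 ->
    msize (p * q) <= (u + v).+1)%N.
  move=> pu qv; have [->|p0] := eqVneq p 0; first by rewrite mul0r msize0.
  have [->|q0] := eqVneq q 0; first by rewrite mulr0 msize0.
  rewrite msizeM // (mpolySpred _ p0) addSn /= -ltnS -addSn -(mpolySpred _ p0).
  by rewrite -addnS -addSn leq_add.
apply: (big_ind2 (fun (p : {mpoly K[n]}) u => msize p <= u.+1)%N).
- by rewrite msize1.
- by move=> p u q v; apply: mul_bound.
move=> i _; elim: (alpha i) => [|e IHe]; first by rewrite expr0 msize1 mul0n.
by rewrite exprS mulSn; apply: mul_bound.
Qed.

(** A count of monomials: if all exponents of the D^(d+1) monomials in the h i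
are less than D, then these monomials lie in the space spanned by the B^d
monomials with exponents less than B = c D, and B^d < D^(d+1) as D > c^d. *)
Lemma algebraic_dependence d (h : 'I_d.+1 -> {mpoly K[d]}) :
  exists2 G : {mpoly K[d.+1]}, G != 0 & msubst h G = 0.
Proof.
pose b := (\max_i msize (h i))%N.
have hb i : (msize (h i) <= b.+1)%N by apply: leqW; apply: leq_bigmax.
pose c := (d.+1 * b).+1; pose D := (c ^ d).+1; pose B := (c * D)%N.
pose J : finType := {ffun 'I_d.+1 -> 'I_D}; pose I : finType := {ffun 'I_d -> 'I_B}.
pose mon (a : J) := [multinom val (a i) | i < d.+1].
pose monI (a : I) := [multinom val (a i) | i < d].
pose P (a : J) := msubst h 'X_[mon a].
have [|co [a0 ca0] co_eq] := @underdetermined_system K I J (fun u a => (P a)@_(monI u)).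
  by rewrite !card_ffun !card_ord /B expnMn expnSr mulnC ltn_pmul2l ?expn_gt0.
have mon_inj : injective mon.
  move=> a a' e; apply/ffunP => i; apply: val_inj.
  by have := congr1 (fun m : 'X_{1..d.+1} => m i) e; rewrite !mnmE.
exists (\sum_a co a *: 'X_[mon a]).
  apply: contraNneq ca0 => G0; have := congr1 (mcoeff (mon a0)) G0.
  rewrite mcoeff_bigsum mcoeff0 /= (bigD1 a0) //= mcoeffZ mcoeffX eqxx mulr1.
  rewrite big1 ?addr0 => [->//|a na].
  by rewrite mcoeffZ mcoeffX (inj_eq mon_inj) (negPf na) mulr0.
apply/mpolyP => m; rewrite mcoeff0 msubst_sum mcoeff_bigsum.
have [/forallP mB|] := boolP [forall i, (m i < B)%N].
  rewrite -[RHS](co_eq [ffun i => Ordinal (mB i)]); apply: eq_bigr => a _.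
  rewrite mmapZ mul_mpolyC mcoeffZ mulrC; congr (_@_ _ * _).
  by apply/mnmP => i; rewrite mnmE ffunE.
rewrite negb_forall => /existsP[i]; rewrite -leqNgt => Bm.
rewrite big1 // => a _; rewrite mmapZ mul_mpolyC mcoeffZ.
suff /memN_msupp_eq0 -> : m \notin msupp (msubst h 'X_[mon a]) by rewrite mulr0.
apply: msize_mdeg_ge; rewrite mmapX /mmap1.
have mdegB : (B <= mdeg m)%N by rewrite mdegE (bigD1 i) //= (leq_trans Bm) ?leq_addr.
apply: leq_trans mdegB.
apply: leq_trans (msize_prod_bound (fun i => mon a i) hb) _.
have : (\sum_i mon a i * b <= \sum_(i < d.+1) c ^ d * b)%N.
  by apply: leq_sum => i' _; rewrite leq_mul2r mnmE -ltnS ltn_ord orbT.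
rewrite sum_nat_const card_ord => /leq_ltn_trans; apply.
by rewrite /B /D /c; move: (_ ^ d)%N => e; nia.
Qed.

Lemma msize_mderiv n i (p : {mpoly K[n]}) :
  p != 0 -> (msize (mderiv i p) < msize p)%N.
Proof.
move=> p0; rewrite [X in (X < _)%N]msizeE.
rewrite (mpolySpred _ p0) ltnS; apply/bigmax_leqP_seq => m.
rewrite mcoeff_msupp mcoeff_mderiv => nz _.
rewrite -ltnS -(mpolySpred _ p0).
have : (m + U_(i))%MM \in msupp p.
  by rewrite mcoeff_msupp; apply: contraNneq nz => ->; rewrite mul0rn.
by move/msize_mdeg_lt; rewrite mdegD mdeg1 addn1.
Qed.

Lemma mderiv_eq0_const n (p : {mpoly K[n]}) :
  (forall i, mderiv i p = 0) -> p = (p@_0)%:MP.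
Proof.
move=> dp; apply/mpolyP => m; rewrite mcoeffC.
have [->|m0] := eqVneq 0%MM m; first by rewrite mulr1.
rewrite mulr0; have [i mi] : exists i, (0 < m i)%N.
  apply/existsP; apply: contraNT m0; rewrite negb_exists => /forallP m0.
  by apply/eqP/mnmP => i; rewrite mnm0E; apply/esym/eqP; rewrite -leqn0 leqNgt.
have := congr1 (mcoeff (m - U_(i))%MM) (dp i).
rewrite mcoeff0 mcoeff_mderiv submK; last by rewrite lep1mP -lt0n.
move=> /eqP; rewrite -mulr_natr mulf_eq0 => /orP[/eqP//|].
by have /pcharf0P -> := charK.
Qed.

(** A relation G of minimal size would, differentiated by the chain rule, give the
relations dG/dX_l among the h, because L times the Jacobian, being the identity
at p, has a nonzero determinant. These are smaller, hence zero, so that G is constant. *)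
Lemma jacobian_independence n q (h : 'I_q -> {mpoly K[n]}) (L : 'I_q -> 'I_n -> K) p :
  (forall l l', \sum_s L l s * (mderiv s (h l')).@[p] = (l == l')%:R) ->
  forall G, msubst h G = 0 -> G = 0.
Proof.
move=> jac G; have [b] := ubnP (msize G); elim: b G => // b IHb G Gb hG.
apply/eqP/negPn/negP => G0.
pose N : 'M[{mpoly K[n]}]_q := \matrix_(l, l') \sum_s L l s *: mderiv s (h l').
have N0 : \det N != 0.
  apply: contraTneq (oner_neq0 K) => N0; rewrite negbK.
  suff <- : (\det N).@[p] = 1 by rewrite N0 meval0.
  rewrite -det_map_mx; suff -> : map_mx (meval p) N = 1%:M by rewrite det1.
  apply/matrixP => l l'; rewrite !mxE -jac raddf_sum; apply: eq_bigr => s _ /=.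
  by rewrite mevalZ.
have dG l : msubst h (mderiv l G) = 0.
  pose v := \col_l msubst h (mderiv l G).
  have Nv : N *m v = 0.
    apply/colP => l'; rewrite !mxE.
    under eq_bigr => l1 _ do rewrite !mxE mulr_suml.
    rewrite exchange_big /= big1 // => s _.
    have := mderiv_msubst h s G; rewrite hG mderiv0 => /esym e.
    rewrite -[RHS](scaler0 _ (L l' s)) -[in RHS]e scaler_sumr; apply: eq_bigr => l1 _.
    by rewrite mulrC -scalerAr.
  have : \det N *: v = 0 by rewrite -mul_scalar_mx -mul_adj_mx -mulmxA Nv mulmx0.
  move/colP/(_ l); rewrite !mxE => /eqP; rewrite mulf_eq0 (negPf N0) => /eqP.
  by [].
have /mderiv_eq0_const Gc : forall l, mderiv l G = 0.
  by move=> l; apply: IHb => //; apply: leq_trans (msize_mderiv l G0) _.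
move: hG; rewrite Gc mmapC => /eqP; rewrite mpolyC_eq0 => /eqP c0.
by rewrite Gc c0 mpolyC0 eqxx in G0.
Qed.

End Substitution.

(** * Prime chains and dimension *)

Lemma largest_eq (P : set nat) s : P s -> (forall t, P t -> (t <= s)%N) -> largest P = s.
Proof.
move=> Ps maxs; rewrite /largest; apply: xget_unique; first by split.
by move=> t [Pt maxt]; apply/eqP; rewrite eqn_leq maxs // maxt.
Qed.

Lemma largest_spec (P : set nat) s b : P s -> (forall t, P t -> (t <= b)%N) ->
  P (largest P) /\ forall t, P t -> (t <= largest P)%N.
Proof.
move=> Ps bP; have [s' Ps' maxs'] : exists2 s', P s' & forall t, P t -> (t <= s')%N.
  have exP : exists s, `[< P s >] by exists s; apply/asboolP.
  have bP' t : `[< P t >] -> (t <= b)%N by move/asboolP/bP.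
  case: (ex_maxnP exP bP') => s' /asboolP Ps' maxs'.
  by exists s' => // t Pt; apply: maxs'; apply/asboolP.
by rewrite (largest_eq Ps' maxs').
Qed.

Lemma mderiv_bigsum (K : fieldType) n i (J : Type) (s : seq J) (P : pred J)
    (f : J -> {mpoly K[n]}) :
  mderiv i (\sum_(j <- s | P j) f j) = \sum_(j <- s | P j) mderiv i (f j).
Proof. exact: raddf_sum. Qed.

Section PrimeChains.
Local Open Scope classical_set_scope.
Variables (K : fieldType) (charK : [pchar K] =i pred0).

Lemma prime_idealP (I : finType) (P : set {mpoly K[#|I|]}) : prime_ideal P <->
  [/\ P 0, ~ P 1, forall a u v, P u -> P v -> P (a * u + v) &
      forall u v, P (u * v) -> P u \/ P v].
Proof.
split=> [[[P0 P1 PD] PM]|[P0 P1 PD PM]].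
  split; first exact: set_mem.
  - by move=> P1'; move/negP: P1; apply; apply: mem_set.
  - by move=> a u v Pu Pv; apply: set_mem; apply: PD; apply: mem_set.
  - by move=> u v /(@mem_set _ P)/PM/orP[] /set_mem; [left|right].
split; first split.
- exact: mem_set.
- by apply/negP => /set_mem.
- by move=> a u v /set_mem Pu /set_mem Pv; apply: mem_set; apply: PD.
by move=> u v /set_mem/PM[] Pu; apply/orP; [left|right]; apply: mem_set.
Qed.

(** The transcendence degree drops along a strict inclusion of primes: an element
u of Q_1 outside Q_0, added to elements that are independent modulo Q_1, gives
elements that are independent modulo Q_0. *)
Lemma prime_chain_independent (I : finType) e (Q : nat -> set {mpoly K[#|I|]}) :
  (forall i, (i <= e)%N -> prime_ideal (Q i)) ->
  (forall i, (i < e)%N -> Q i `<` Q i.+1) ->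
  exists g : 'I_e -> {mpoly K[#|I|]},
    forall G, G != 0 -> ~ Q 0%N (msubst g G).
Proof.
elim: e Q => [|e IHe] Q primeQ ltQ.
  exists (fun=> 0) => G; rewrite [G]nvar0_mpolyC mpolyC_eq0 mmapC => c0.
  have /prime_idealP[Q0 Q1 QD _] := primeQ 0%N isT => Qc; apply: Q1.
  by have := QD (G@_0)^-1%:MP _ _ Qc Q0; rewrite addr0 -mpolyCM mulVf.
have [g' indep] : exists g : 'I_e -> {mpoly K[#|I|]}, forall G, G != 0 -> ~ Q 1%N (msubst g G).
  by apply: (IHe (fun i => Q i.+1)) => i ie; [apply: primeQ | apply: ltQ].
have [sub01 [u Q1u Q0u]] : Q 0%N `<=` Q 1%N /\ exists2 u, Q 1%N u & ~ Q 0%N u.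
  have [Q01 /existsNP[u /not_implyP[Q1u Q0u]]] := ltQ 0%N isT.
  by split=> //; exists u.
have /prime_idealP[Q00 _ _ Q0M] := primeQ 0%N isT.
have /prime_idealP[Q10 _ Q1D _] := primeQ 1%N isT.
pose E (q : {poly {mpoly K[e]}}) := (map_poly (msubst g') q).[u].
(* Dividing by the variable as often as possible, the constant term of a relation
   for u is a relation modulo Q_1 among the g'. *)
have E_notin q : q != 0 -> ~ Q 0%N (E q).
  elim/poly_ind: q => [|q c IHq]; first by rewrite eqxx.
  have EqE : E (q * 'X + c%:P) = E q * u + msubst g' c.
    by rewrite /E rmorphD rmorphM /= map_polyX map_polyC hornerMXaddC.
  rewrite EqE; have [->|c0] := eqVneq c 0.
    rewrite mmap0 !addr0 => qX0 /Q0M[|//]; apply: IHq.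
    by apply: contraNneq qX0 => ->; rewrite mul0r.
  move=> _ /sub01 Q1E; apply: (indep c c0).
  by rewrite -[msubst g' c](addKr (E q * u)) -mulNr; apply: Q1D.
exists (fun i => if unlift ord_max i is Some j then g' j else u) => G G0.
set g := fun i => _.
suff -> : msubst g G = E (muni G).
  apply: E_notin; apply: contraNneq G0 => muni0; apply/eqP/(mpoly_ext charK) => v.
  by rewrite meval_muni muni0 raddf0 horner0 meval0.
apply: (mpoly_ext charK) => v; rewrite meval_msubst meval_muni /E.
rewrite -horner_map -map_poly_comp /g unlift_none /=; congr (_.[_]).
apply: eq_map_poly => c /=; rewrite meval_msubst; apply: meval_eq => i.
by rewrite widen_lift liftK.
Qed.

(** X stands for the closure of the image of f, known through its ideal. *)
Variables (I : finType) (d : nat) (f : 'I_#|I| -> {mpoly K[d]}).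
Variable X : set {ffun I -> K}.
Hypothesis idealX : forall g, vanishing_ideal X g <-> msubst f g = 0.

Lemma prime_chain_bound e : prime_chain X e -> (e <= d)%N.
Proof.
case=> Q [primeQ ltQ]; rewrite leqNgt; apply/negP => de.
have [g indep] : exists g : 'I_d.+1 -> {mpoly K[#|I|]}, forall G, G != 0 -> ~ Q 0%N (msubst g G).
  apply: prime_chain_independent => i id; last by apply: ltQ; apply: leq_trans id _.
  by have [] := primeQ i (leq_trans id de).
have [G G0 Gdep] := algebraic_dependence (fun i => msubst f (g i)).
apply: (indep G G0); have [_] := primeQ 0%N isT; apply; apply/idealX.
by rewrite (msubst_msubst charK).
Qed.

(** The Jacobian of f at p has a right inverse R, so that the d combinations Y l
of the coordinates, with coefficients R a l, are local coordinates near p. *)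
Variables (p : 'I_d -> K) (R : 'I_#|I| -> 'I_d -> K).
Hypothesis jac : forall s l, \sum_a (mderiv s (f a)).@[p] * R a l = (s == l)%:R.

(** Freeze all but the first j parameters at their values at p; kernel j is the
ideal of the image of the restricted family. *)
Let restr j (l : 'I_d) : {mpoly K[d]} := if (l < j)%N then 'X_l else (p l)%:MP.
Let kernel j : set {mpoly K[#|I|]} :=
  [set g | msubst (restr j) (msubst f g) = 0].

Let kernel_prime j : prime_ideal (kernel j).
Proof.
apply/prime_idealP; rewrite /kernel; split=> /=; first by rewrite !mmap0.
- by rewrite !rmorph1; apply/eqP; rewrite oner_eq0.
- by move=> a u v u0 v0; rewrite !(mmapD, rmorphM) /= u0 v0 mulr0 addr0.
by move=> u v; rewrite !rmorphM /= => /eqP; rewrite mulf_eq0 => /orP[] /eqP; [left|right].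
Qed.

Let restr_restr j v : (fun l => (restr j l).@[v]) = (fun l => if (l < j)%N then v l else p l).
Proof. by apply/funext => l; rewrite /restr; case: ifP; rewrite ?mevalXU ?mevalC. Qed.

Let kernel_sub j : kernel j.+1 `<=` kernel j.
Proof.
move=> g gj; apply: (mpoly_ext charK) => v; rewrite meval0.
have := congr1 (meval (fun l => if (l < j)%N then v l else p l)) gj.
rewrite meval0 !meval_msubst !restr_restr => e; rewrite -[RHS]e.
apply: meval_eq => a; apply: meval_eq => l.
by case: (boolP (l < j)%N) => lj; rewrite ?(leqW lj) ?if_same.
Qed.

(** The functions Y l for l < j + 1 are dependent on a family with j parameters,
and independent, by the Jacobian criterion, on one with j + 1 parameters. *)
Let kernel_proper j : (j < d)%N -> kernel j.+1 `<` kernel j.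
Proof.
move=> jd; split; first exact: kernel_sub.
pose Y (l : 'I_d) : {mpoly K[#|I|]} := \sum_a R a l *: 'X_a.
pose w : 'I_j.+1 -> 'I_d := widen_ord jd.
pose w' (l : 'I_j) : 'I_d := widen_ord (ltnW jd) l.
(* The restriction to the first j parameters, in a ring of j variables. *)
pose tau (l : 'I_d) : {mpoly K[j]} := if insub (val l) is Some i then 'X_i else (p l)%:MP.
have restrE l : restr j l = msubst (fun i => 'X_(w' i)) (tau l).
  rewrite /restr /tau; case: insubP => [i il eil|]; last first.
    by move=> /negPf->; rewrite mmapC.
  by rewrite il mmapX mmap1U; congr 'X_(_); apply: val_inj.
have [G G0 Gdep] := algebraic_dependence (fun l => msubst tau (msubst f (Y (w l)))).
have fY G' : msubst f (msubst (fun l => Y (w l)) G') = msubst (fun l => msubst f (Y (w l))) G'.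
  by rewrite (msubst_msubst charK).
have in_j : kernel j (msubst (fun l => Y (w l)) G).
  rewrite /kernel /= fY (msubst_msubst charK).
  have -> : (fun i => msubst (restr j) (msubst f (Y (w i)))) =
     (fun i => msubst (fun i => 'X_(w' i)) (msubst tau (msubst f (Y (w i))))).
    apply/funext => i; rewrite [RHS](msubst_msubst charK); congr (mmap _ _ _).
    by apply/funext => l; apply: restrE.
  by rewrite -(msubst_msubst charK) Gdep mmap0.
move=> /(_ _ in_j); rewrite /kernel /= fY (msubst_msubst charK).
move/(jacobian_independence charK (L := fun l s => (s == w l)%:R) (p := p)) => Geq0.
case/eqP: G0; apply: Geq0 => l l'.
rewrite (bigD1 (w l)) //= eqxx mul1r big1 ?addr0 => [|s /negPf->]; last by rewrite mul0r.
have restr_p : (fun l => (restr j.+1 l).@[p]) = p.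
  by rewrite restr_restr; apply/funext => s; case: ifP.
rewrite mderiv_msubst raddf_sum /= (bigD1 (w l)) //= big1 ?addr0 => [|s sl].
  rewrite mevalM meval_msubst restr_p.
  have -> : mderiv (w l) (restr j.+1 (w l)) = 1.
    have lw : (w l < j.+1)%N by exact: ltn_ord l.
    by rewrite /restr lw mderiv_var eqxx.
  rewrite meval1 mulr1 /Y msubst_sum mderiv_bigsum raddf_sum /=.
  have <- : (w l == w l') = (l == l').
    by apply/eqP/eqP => [/(congr1 val) e|->//]; apply: val_inj.
  rewrite -jac; apply: eq_bigr => a _.
  by rewrite mmapZ mul_mpolyC mderivZ mevalZ mmapX mmap1U mulrC.
rewrite mevalM [mderiv _ (restr _ _)](_ : _ = 0) ?meval0 ?mulr0 //.
rewrite /restr; case: ifP => _; last by rewrite mderivC.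
by rewrite mderiv_var (negPf sl).
Qed.

Lemma prime_chain_exists : prime_chain X d.
Proof.
exists (fun i => kernel (d - i)%N); split=> i id.
  by split; [exact: kernel_prime | move=> g /idealX gf; rewrite /kernel /= gf mmap0].
have -> : (d - i = (d - i.+1).+1)%N by lia.
by apply: kernel_proper; lia.
Qed.

End PrimeChains.

Section ZariskiDimension.
Local Open Scope classical_set_scope.
Variables (K : fieldType) (charK : [pchar K] =i pred0) (I : finType).
Implicit Types X : set {ffun I -> K}.

Lemma vanishing_ideal_closure X : vanishing_ideal (zariski_closure X) = vanishing_ideal X.
Proof.
apply/seteqP; split=> g gX x Xx; first by apply: gX => Y [_ sXY]; apply: sXY.
have : zero_locus [set g] x.
  by apply: Xx; split; [exists [set g] | move=> y Xy h ->; apply: gX].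
by apply.
Qed.

Lemma zariski_dim_parametrized X d (f : 'I_#|I| -> {mpoly K[d]}) (p : 'I_d -> K)
    (R : 'I_#|I| -> 'I_d -> K) :
  (forall g, vanishing_ideal X g <-> msubst f g = 0) ->
  (forall s l, \sum_a (mderiv s (f a)).@[p] * R a l = (s == l)%:R) ->
  zariski_dim X = d.
Proof.
move=> idealX jac; have idealX' g : vanishing_ideal (zariski_closure X) g <-> msubst f g = 0.
  by rewrite vanishing_ideal_closure.
apply: largest_eq; first exact: (prime_chain_exists charK idealX' jac).
by move=> t; apply: (prime_chain_bound charK idealX').
Qed.

Lemma zariski_dense_vanishing X :
  (forall g, vanishing_ideal X g -> g = 0) -> zariski_dense X.
Proof.
move=> idealX; apply/seteqP; split=> // x _ Y [[S ->] XS] g Sg.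
by rewrite (idealX g) /peval ?meval0 // => y Xy; apply: (XS y Xy).
Qed.

Lemma zariski_dense_nonempty X : zariski_dense X -> X !=set0.
Proof.
move=> denseX; apply/set0P/negP => /eqP X0.
have : zariski_closure X [ffun=> 0] by rewrite denseX.
move=> /(_ set0); case; split; last by rewrite X0.
exists [set 1]; apply/esym/seteqP; split=> // x /(_ 1 erefl) /eqP.
by rewrite /peval meval1 oner_eq0.
Qed.

End ZariskiDimension.

(** * Tensors and subrank *)

Lemma prod_sum_dffun (S : comNzRingType) (I : finType) (T : I -> finType)
    (F : forall i, T i -> S) :
  \prod_i \sum_(x : T i) F i x = \sum_(f : {dffun forall i, T i}) \prod_i F i (f i).
Proof.
pose P i : {ffun T i -> S} := [ffun x => F i x].
transitivity (\prod_i \sum_(x : T i) P i x).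
  by apply: eq_bigr => i _; apply: eq_bigr => x _; rewrite ffunE.
under eq_bigr => i _ do rewrite (big_tag (fun i => P i)).
rewrite bigA_distr_big_dep -(big_fprod _ _ P) (reindex (@fprod_of_dffun I T)) /=; last first.
  by apply: onW_bij; apply: fprod_of_dffun_bij.
by apply: eq_bigr => f _; apply: eq_bigr => i _; rewrite fprodE ffunE.
Qed.

Lemma card_midx k (n : 'I_k -> nat) : #|midx n| = (\prod_i n i)%N.
Proof.
rewrite -(bij_eq_card (@dffun_of_fprod_bij _ (fun i : 'I_k => 'I_(n i)))) card_fprod.
by apply: eq_bigr => i _; rewrite card_ord.
Qed.

Section TensorAction.
Variables (K : fieldType) (k : nat).

Lemma tensor_act_comp (l m n : 'I_k -> nat) (A : forall i, 'M[K]_(l i, m i))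
    (B : forall i, 'M[K]_(m i, n i)) (T : tensor K n) :
  tensor_act A (tensor_act B T) = tensor_act (fun i => A i *m B i) T.
Proof.
apply/ffunP => a; rewrite !ffunE.
under eq_bigr => b _ do rewrite ffunE mulr_sumr.
rewrite exchange_big /=; apply: eq_bigr => c _.
under [in RHS]eq_bigr => i _ do rewrite mxE.
rewrite prod_sum_dffun mulr_suml; apply: eq_bigr => b _.
by rewrite big_split /= mulrA.
Qed.

(** Rows of the A i that are unit vectors pick an entry. *)
Lemma tensor_act_select (m n : 'I_k -> nat) (A : forall i, 'M[K]_(m i, n i))
    (T : tensor K n) (a : midx m) (h : midx n) :
  (forall i y, A i (a i) y = (h i == y)%:R) -> tensor_act A T a = T h.
Proof.
move=> Ah; rewrite ffunE (bigD1 h) //= [X in _ + X]big1 ?addr0 => [|b bh].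
  by rewrite big1 ?mul1r // => i _; rewrite Ah eqxx.
have [i hb] := neq_midx bh.
by rewrite (bigD1 i) //= Ah eq_sym (negPf hb) !mul0r.
Qed.

Lemma tensor_act1 (n : 'I_k -> nat) (T : tensor K n) :
  tensor_act (fun i => 1%:M) T = T.
Proof. by apply/ffunP => a; apply: tensor_act_select => i y; rewrite mxE. Qed.

Lemma eq_tensor_act (m n : 'I_k -> nat) (A B : forall i, 'M[K]_(m i, n i)) (T : tensor K n) :
  (forall i, A i = B i) -> tensor_act A T = tensor_act B T.
Proof.
move=> AB; apply/ffunP => a; rewrite !ffunE; apply: eq_bigr => b _; congr (_ * _).
by apply: eq_bigr => i _; rewrite AB.
Qed.

Lemma restricts_trans (l m n : 'I_k -> nat) (R : tensor K l) (S : tensor K m) (T : tensor K n) :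
  restricts R S -> restricts S T -> restricts R T.
Proof.
move=> [A <-] [B <-]; exists (fun i => A i *m B i); by rewrite tensor_act_comp.
Qed.

Variable k_ge2 : (2 <= k)%N.
Let i0 : 'I_k := Ordinal (ltnW k_ge2).

Definition diagonal s (a : midx (fun _ : 'I_k => s)) : bool :=
  [exists j, [forall i, a i == j]].

Lemma diagonalP s (a : midx (fun _ : 'I_k => s)) :
  reflect (exists j, forall i, a i = j) (diagonal a).
Proof.
apply: (iffP existsP) => -[j aj]; exists j; first by move=> i; apply/eqP/(forallP aj).
by apply/forallP => i; rewrite aj.
Qed.

Lemma unit_tensorE s (a : midx (fun _ : 'I_k => s)) :
  unit_tensor K k s a = (diagonal a)%:R.
Proof.
rewrite ffunE; case: diagonalP => [[j aj]|nd].
  rewrite (bigD1 j) //= big1 ?mul1r => [|i _]; last by rewrite aj eqxx.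
  rewrite big1 ?addr0 // => j' jj'.
  by rewrite (bigD1 i0) //= aj eq_sym (negPf jj') mul0r.
apply: big1 => j _; have [i aij] : exists i, a i != j.
  apply/existsP; apply: contra_notT nd; rewrite negb_exists => /forallP aj.
  by exists j => i; apply/eqP; have := aj i; rewrite negbK.
by rewrite (bigD1 i) //= (negPf aij) mul0r.
Qed.

Lemma unit_tensor_le r s : (r <= s)%N -> restricts (unit_tensor K k r) (unit_tensor K k s).
Proof.
move=> rs; exists (fun i => \matrix_(x, y) (widen_ord rs x == y)%:R).
apply/ffunP => a.
rewrite (@tensor_act_select _ _ _ _ a (finfun (fun i => widen_ord rs (a i)))); last first.
  by move=> i y; rewrite mxE ffunE.
rewrite !unit_tensorE; congr (nat_of_bool _)%:R; apply/diagonalP/diagonalP => -[j aj].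
  exists (a i0) => i; apply: val_inj.
  have /(congr1 val) := aj i; have /(congr1 val) := aj i0.
  by rewrite !ffunE /= => -> ->.
by exists (widen_ord rs j) => i; rewrite ffunE aj.
Qed.

(** A relation y between the rows of A i contracts the unit tensor to 0 in
direction i; the entry at the diagonal point j of the contraction is y_j. *)
Lemma restricts_unit_free s (n : 'I_k -> nat) (A : forall i, 'M[K]_(s, n i)) (T : tensor K n) i :
  tensor_act A T = unit_tensor K k s -> row_free (A i).
Proof.
move=> AT; rewrite -kermx_eq0; apply/eqP/row_matrixP => t; rewrite row0.
have : row t (kermx (A i)) *m A i = 0 by rewrite -row_mul mulmx_ker row0.
move: (row t _) => y yA; apply/rowP => j; rewrite mxE.
pose c : midx (fun _ : 'I_k => s) := finfun (fun _ => j).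
have [i1 i10] : exists i1, i1 != i.
  have [->|ni0] := eqVneq i i0; last by exists i0; rewrite eq_sym.
  by exists (Ordinal k_ge2).
transitivity (\sum_x y 0 x * tensor_act A T (upd c i x)).
  rewrite AT (bigD1 j) //= unit_tensorE big1 ?addr0.
    suff -> : diagonal (upd c i j) by rewrite mulr1.
    apply/diagonalP; exists j => i'; have [->|ii] := eqVneq i' i; first by rewrite upd_same.
    by rewrite upd_other // ffunE.
  move=> x xj; rewrite unit_tensorE; case: diagonalP => [[j' cj]|]; rewrite ?mulr0 //.
  have := cj i; have := cj i1; rewrite upd_same upd_other // ffunE => jj' xj'.
  by rewrite xj' -jj' eqxx in xj.
under eq_bigr => x _ do rewrite ffunE mulr_sumr.
rewrite exchange_big /= big1 // => b _.
under eq_bigr => x _ do rewrite (bigD1 i) //= upd_same mulrA mulrA -mulrA.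
transitivity (\sum_x y 0 x * A i x (b i) * (\prod_(i' | i' != i) A i' j (b i') * T b)).
  apply: eq_bigr => x _; congr (_ * (_ * _)); apply: eq_bigr => i' ii.
  by rewrite upd_other // ffunE.
rewrite -mulr_suml; have := congr1 (fun u : 'rV_ _ => u 0 (b i)) yA.
by rewrite !mxE => ->; rewrite mul0r.
Qed.

Lemma restricts_unit_bound s (n : 'I_k -> nat) (T : tensor K n) i :
  restricts (unit_tensor K k s) T -> (s <= n i)%N.
Proof.
case=> A /(restricts_unit_free i); rewrite /row_free => /eqP <-.
exact: rank_leq_col.
Qed.

(** Unit tensors decrease with their size, and those below T have bounded size. *)
Lemma subrank_geP (n : 'I_k -> nat) r (T : tensor K n) :
  subrank_ge K n r T <-> restricts (unit_tensor K k r) T.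
Proof.
have T0 : restricts (unit_tensor K k 0) T.
  exists (fun i => 0); apply/ffunP => a; by case: (a i0).
have [subT maxT] := largest_spec T0 (fun s => @restricts_unit_bound s n T i0).
split=> [rT|/maxT//].
by apply: restricts_trans subT; apply: unit_tensor_le.
Qed.

Lemma generic_subrank_max (charK : [pchar K] =i pred0) (n : 'I_k -> nat) r :
  zariski_dense (subrank_ge K n r) -> (r <= generic_subrank K n)%N.
Proof.
move=> denser; have bound s : zariski_dense (subrank_ge K n s) -> (s <= n i0)%N.
  by case/zariski_dense_nonempty => T /subrank_geP /restricts_unit_bound.
by have [_] := largest_spec denser bound; apply.
Qed.

End TensorAction.

(** * Polynomial functions of one variable *)

Section PolynomialFunctions.
Variable K : fieldType.

Definition polyfun (phi : K -> K) := exists p : {poly K}, forall s, phi s = p.[s].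

Lemma polyfun_cst c : polyfun (fun=> c).
Proof. by exists c%:P => s; rewrite hornerC. Qed.

Lemma polyfun_id : polyfun id.
Proof. by exists 'X => s; rewrite hornerX. Qed.

Lemma polyfunD phi psi : polyfun phi -> polyfun psi -> polyfun (fun s => phi s + psi s).
Proof. by move=> [p pE] [q qE]; exists (p + q) => s; rewrite hornerD pE qE. Qed.

Lemma polyfunM phi psi : polyfun phi -> polyfun psi -> polyfun (fun s => phi s * psi s).
Proof. by move=> [p pE] [q qE]; exists (p * q) => s; rewrite hornerM pE qE. Qed.

Lemma polyfun_sum (I : Type) (r : seq I) (P : pred I) (phi : I -> K -> K) :
  (forall i, polyfun (phi i)) -> polyfun (fun s => \sum_(i <- r | P i) phi i s).
Proof.
move=> polyphi; have [p pE] := choice polyphi.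
by exists (\sum_(i <- r | P i) p i) => s; rewrite horner_sum; apply: eq_bigr.
Qed.

Lemma polyfun_prod (I : Type) (r : seq I) (P : pred I) (phi : I -> K -> K) :
  (forall i, polyfun (phi i)) -> polyfun (fun s => \prod_(i <- r | P i) phi i s).
Proof.
move=> polyphi; have [p pE] := choice polyphi.
by exists (\prod_(i <- r | P i) p i) => s; rewrite horner_prod; apply: eq_bigr.
Qed.

Lemma polyfun_exp phi e : polyfun phi -> polyfun (fun s => phi s ^+ e).
Proof. by move=> [p pE]; exists (p ^+ e) => s; rewrite horner_exp pE. Qed.

Lemma polyfun_det n (M : K -> 'M[K]_n) :
  (forall i j, polyfun (fun s => M s i j)) -> polyfun (fun s => \det (M s)).
Proof.
move=> polyM; rewrite /determinant; apply: polyfun_sum => sigma.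
by apply: polyfunM; [apply: polyfun_cst | apply: polyfun_prod].
Qed.

Lemma polyfun_adj n (M : K -> 'M[K]_n) i j :
  (forall i j, polyfun (fun s => M s i j)) -> polyfun (fun s => (\adj (M s)) i j).
Proof.
move=> polyM.
have -> : (fun s => (\adj (M s)) i j) =
   (fun s => (-1) ^+ (j + i) * \det (row' j (col' i (M s)))).
  by apply/funext => s; rewrite mxE.
apply: polyfunM; first exact: polyfun_cst.
apply: polyfun_det => i' j'; have [p pE] := polyM (lift j i') (lift i j').
by exists p => s; rewrite !mxE.
Qed.

Lemma polyfun_mulmx m n p (M : K -> 'M[K]_(m, n)) (N : K -> 'M[K]_(n, p)) i j :
  (forall i j, polyfun (fun s => M s i j)) -> (forall i j, polyfun (fun s => N s i j)) ->
  polyfun (fun s => (M s *m N s) i j).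
Proof.
move=> polyM polyN.
have -> : (fun s => (M s *m N s) i j) = (fun s => \sum_l M s i l * N s l j).
  by apply/funext => s; rewrite mxE.
by apply: polyfun_sum => l; apply: polyfunM.
Qed.

Lemma polyfun_meval n (g : {mpoly K[n]}) (v : 'I_n -> K -> K) :
  (forall j, polyfun (v j)) -> polyfun (fun s => g.@[fun j => v j s]).
Proof.
move=> polyv; under eq_fun => s do rewrite mevalE.
apply: polyfun_sum => m; apply: polyfunM; first exact: polyfun_cst.
by apply: polyfun_prod => j; apply: polyfun_exp.
Qed.

(** The product of phi and e vanishes everywhere, and e is not the zero
polynomial. *)
Lemma polyfun_vanish (charK : [pchar K] =i pred0) phi e s1 : polyfun phi -> polyfun e ->
  e s1 != 0 -> (forall s, e s != 0 -> phi s = 0) -> forall s, phi s = 0.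
Proof.
move=> [p pE] [q qE] e1 phi0 s.
have q0 : q != 0 by apply: contraNneq e1 => q0; rewrite qE q0 horner0.
suff : p * q = 0.
  by move/eqP; rewrite mulf_eq0 (negPf q0) orbF pE => /eqP ->; rewrite horner0.
apply/eqP/negPn/negP => /(poly_nonvanishing charK)[t].
rewrite hornerM mulf_eq0 negb_or -pE -qE => /andP[phit /phi0 phit0].
by rewrite phit0 eqxx in phit.
Qed.

End PolynomialFunctions.

(** * Completion of rectangular matrices *)

Section CoordinateProjection.
Variables (K : fieldType) (r n : nat) (rn : (r <= n)%N).
Let P : 'M[K]_(r, n) := pid_mx r.

Lemma pid_projE (x : 'I_r) (y : 'I_n) : P x y = (widen_ord rn x == y)%:R.
Proof. by rewrite mxE ltn_ord andbT -val_eqE. Qed.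

Lemma pid_proj_trE (y : 'I_n) (x : 'I_r) : P^T y x = (widen_ord rn x == y)%:R.
Proof. by rewrite mxE pid_projE. Qed.

Lemma pid_projK : P *m P^T = 1%:M.
Proof.
apply/matrixP => x y; rewrite !mxE (bigD1 (widen_ord rn x)) //= big1 => [|z nz].
  by rewrite pid_projE pid_proj_trE eqxx mul1r addr0 -!val_eqE /= eq_sym.
by rewrite pid_projE eq_sym (negPf nz) mul0r.
Qed.

(** The projection onto the last n - r coordinates. *)
Let E : 'M[K]_n := locked (1%:M - P^T *m P).

Let PE : P *m E = 0.
Proof. by rewrite /E -lock mulmxBr mulmx1 mulmxA pid_projK mul1mx subrr. Qed.

Let EPt : E *m P^T = 0.
Proof. by rewrite /E -lock mulmxBl mul1mx -mulmxA pid_projK mulmx1 subrr. Qed.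

Let EE : E *m E = E.
Proof. by rewrite {2}/E -lock mulmxBr mulmx1 mulmxA EPt mul0mx subr0. Qed.

Let EE1 : P^T *m P + E = 1%:M.
Proof. by rewrite /E -lock addrC subrK. Qed.

Let E_low (x : 'I_n) l : (r <= x)%N -> E x l = (x == l)%:R.
Proof.
move=> rx; rewrite /E -lock !mxE big1 ?subr0 // => z _.
rewrite pid_proj_trE; case: eqP => [e|_]; last by rewrite mul0r.
by move: rx; rewrite -e /= leqNgt ltn_ord.
Qed.

(** A matrix of rank r is L (1 0) R with L and R invertible; L extends to the
block diagonal matrix of L and 1. *)
Lemma free_completion (A : 'M[K]_(r, n)) : row_free A ->
  exists2 Y, Y \in unitmx & A = P *m Y.
Proof.
move=> freeA; have rkA : \rank A = r by apply/eqP.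
pose blk (L : 'M[K]_r) := P^T *m L *m P + E.
have blkM L L' : L *m L' = 1%:M -> blk L *m blk L' = 1%:M.
  move=> LL'; rewrite /blk mulmxDl !mulmxDr EE.
  rewrite -!mulmxA PE !mulmx0 [P *m (P^T *m _)]mulmxA pid_projK mul1mx.
  by rewrite [L *m (L' *m _)]mulmxA LL' mul1mx [E *m _]mulmxA EPt mul0mx addr0 add0r.
exists (blk (col_ebase A) *m row_ebase A).
  rewrite unitmx_mul row_ebase_unit andbT.
  have := blkM _ _ (mulmxV (col_ebase_unit A)).
  by move/mulmx1_unit => [].
rewrite /blk mulmxA mulmxDr PE addr0 !mulmxA pid_projK mul1mx.
by rewrite -[LHS]mulmx_ebase rkA.
Qed.

(** The inverse of a block matrix (C' A''; 0 1) is (C -C A''; 0 1) with C = C'^-1,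
where (C' A'') = A. *)
Lemma block_upper_inverse (A : 'M[K]_(r, n)) (M : 'M[K]_n) : A *m P^T \in unitmx ->
  (forall x l, M (widen_ord rn x) l = A x l) ->
  (forall (x : 'I_n) l, (r <= x)%N -> M x l = (x == l)%:R) ->
  exists2 N : 'M[K]_n, N *m M = 1%:M &
    (forall x l, N (widen_ord rn x) (widen_ord rn l) = invmx (A *m P^T) x l) /\
    (forall x l : 'I_n, (r <= x)%N -> N x l = (x == l)%:R).
Proof.
move=> unitC Mtop Mlow; set C := invmx _.
have sumP m (B : 'M[K]_(n, m)) x l : (P *m B) x l = B (widen_ord rn x) l.
  rewrite mxE (bigD1 (widen_ord rn x)) //= big1 ?addr0 => [|z zx].
    by rewrite pid_projE eqxx mul1r.
  by rewrite pid_projE eq_sym (negPf zx) mul0r.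
have sumE (B : 'M[K]_n) (x : 'I_n) l : (r <= x)%N -> (E *m B) x l = B x l.
  move=> rx; rewrite mxE (bigD1 x) //= big1 ?addr0 => [|z zx]; rewrite E_low //.
    by rewrite eqxx mul1r.
  by rewrite eq_sym (negPf zx) mul0r.
have EtopE (B : 'M[K]_n) : B = P^T *m (P *m B) + E *m B.
  by rewrite mulmxA -mulmxDl EE1 mul1mx.
have PM : P *m M = A by apply/matrixP => x l; rewrite sumP.
have EM : E *m M = E.
  apply/matrixP => x l; have [rx|xr] := leqP r x; first by rewrite sumE // Mlow // E_low.
  have -> : x = widen_ord rn (Ordinal xr) by apply: val_inj.
  by rewrite -!sumP mulmxA PE mul0mx.
have AC : A *m P^T *m C = 1%:M by rewrite mulmxV.
have [N PN EN] : exists2 N : 'M[K]_n, P *m N = C *m P - C *m (A *m E) & E *m N = E.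
  exists (P^T *m (C *m P - C *m (A *m E)) + E).
    by rewrite mulmxDr PE addr0 mulmxA pid_projK mul1mx.
  by rewrite mulmxDr EE mulmxA EPt mul0mx add0r.
exists N; first apply: mulmx1C.
  rewrite [LHS]EtopE [P *m _]mulmxA PM [E *m _]mulmxA EM EN -[RHS]EE1.
  congr (_ *m _ + _); rewrite [N]EtopE PN EN mulmxDr mulmxA mulmxBr.
  by rewrite [_ *m (C *m P)]mulmxA AC mul1mx [_ *m (C *m _)]mulmxA AC mul1mx subrK.
split=> [x l|x l rx]; last by rewrite -sumE // EN E_low.
rewrite -sumP PN; have -> : forall B : 'M[K]_(r, n), B x (widen_ord rn l) = (B *m P^T) x l.
  move=> B; rewrite mxE (bigD1 (widen_ord rn l)) //= big1 ?addr0 => [|z zl].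
    by rewrite pid_proj_trE eqxx mulr1.
  by rewrite pid_proj_trE eq_sym (negPf zl) mulr0.
by rewrite mulmxBl -!mulmxA EPt !mulmx0 subr0 pid_projK mulmx1.
Qed.

End CoordinateProjection.

Lemma invmx_mul (K : fieldType) n (A B : 'M[K]_n) : A \in unitmx -> B \in unitmx ->
  invmx (A *m B) = invmx B *m invmx A.
Proof.
move=> unitA unitB; have unitAB : A *m B \in unitmx by rewrite unitmx_mul unitA.
rewrite -[RHS](mulKmx unitAB); suff -> : A *m B *m (invmx B *m invmx A) = 1%:M by rewrite mulmx1.
by rewrite mulmxA mulmxK // mulmxV.
Qed.

(** * A parametrization of the tensors of subrank at least r *)

(** The parameters are the entries of S, and those of the first r rows of the
matrices N_i. They are kept together with the ones that the normalization
fixes, so that the family has uniform formulas. *)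
Section Parametrization.
Variables (K : fieldType) (charK : [pchar K] =i pred0).
Variables (k : nat) (k_ge2 : (2 <= k)%N) (n : 'I_k -> nat) (r : nat).
Hypothesis rn : forall i, (r <= n i)%N.
Variable i0 : 'I_k.
Notation point := (midx (fun _ : 'I_k => r)).

Definition in_box (a : midx n) : bool := [forall i, (a i < r)%N].

Definition box (p : point) : midx n := finfun (fun i => widen_ord (rn i) (p i)).

Lemma box_in p : in_box (box p).
Proof. by apply/forallP => i; rewrite ffunE /= ltn_ord. Qed.

Lemma in_boxP a : in_box a -> exists p, a = box p.
Proof.
move=> /forallP lta; exists (finfun (fun i => Ordinal (lta i))).
by apply: eq_midx => i; rewrite !ffunE; apply: val_inj.
Qed.

Lemma box_inj : injective box.
Proof.
move=> p q e; apply: eq_midx => i; apply: val_inj.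
by have := congr1 (fun a : midx n => val (a i)) e; rewrite !ffunE.
Qed.

Definition parameter : finType := (midx n + {i : 'I_k & ('I_r * 'I_(n i))%type})%type.
Definition matrix_parameter i (x : 'I_r) (l : 'I_(n i)) : parameter :=
  inr (Tagged (fun i => ('I_r * 'I_(n i))%type) (x, l)).

Definition diag_in_box (a : midx n) : bool := [exists j : 'I_r, [forall i, a i == j :> nat]].

(** The normalization fixes the entries of S in the box, and for i != i0 the
diagonal of the top block of N_i. *)
Definition is_free (q : parameter) : bool :=
  match q with
  | inl a => ~~ in_box a
  | inr (existT i (x, l)) => (i == i0) || (l != x :> nat)
  end.

Definition fixed_value (q : parameter) : K := if q is inl a then (diag_in_box a)%:R else 1.

Lemma diag_in_boxE p : diag_in_box (box p) = diagonal p.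
Proof.
apply: eq_existsb => j; apply: eq_forallb => i; by rewrite ffunE -val_eqE.
Qed.

Section Family.
Variable S : comNzRingType.
Implicit Types u : parameter -> S.

Definition factor_entry u i (x l : 'I_(n i)) : S :=
  if insub (val x) is Some x' then u (matrix_parameter x' l) else (x == l)%:R.

Definition family_coord u (a : midx n) : S :=
  \sum_(b : midx n) (\prod_(i < k) factor_entry u (a i) (b i)) * u (inl b).

Lemma factor_entry_top u i (x : 'I_r) l :
  factor_entry u (widen_ord (rn i) x) l = u (matrix_parameter x l).
Proof. by rewrite /factor_entry /= valK. Qed.

Lemma factor_entry_low u i (x l : 'I_(n i)) : (r <= x)%N -> factor_entry u x l = (x == l)%:R.
Proof. by move=> rx; rewrite /factor_entry insubF // ltnNge rx. Qed.

End Family.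

Definition family_tensor (u : parameter -> K) : tensor K n := [ffun a => family_coord u a].

Lemma family_tensorE u : family_tensor u =
  tensor_act (fun i => \matrix_(x, l) factor_entry u x l) [ffun b => u (inl b)].
Proof.
apply/ffunP => a; rewrite !ffunE; apply: eq_bigr => b _; rewrite ffunE; congr (_ * _).
by apply: eq_bigr => i _; rewrite mxE.
Qed.

Definition normalized (u : parameter -> K) := forall q, ~~ is_free q -> u q = fixed_value q.

(** Undo the action of the N_i and project onto the box. *)
Lemma family_subrank u : normalized u ->
  (forall i, \matrix_(x, l) factor_entry u (i := i) x l \in unitmx) ->
  restricts (unit_tensor K k r) (family_tensor u).
Proof.
move=> norm_u unitN.
exists (fun i => pid_mx r *m invmx (\matrix_(x, l) factor_entry u (i := i) x l)).
rewrite family_tensorE tensor_act_comp.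
rewrite (eq_tensor_act (B := fun i => pid_mx r)) => [|i]; last by rewrite mulmxKV.
apply/ffunP => a; rewrite (@tensor_act_select _ _ _ _ _ _ _ (box a)) => [|i y].
  by rewrite ffunE norm_u /= ?diag_in_boxE ?unit_tensorE // box_in.
by rewrite ffunE; apply: pid_projE.
Qed.

(** If the leading blocks of the A i are invertible, complete A i by rows of the
identity matrix to an invertible matrix, whose inverse is N_i. Scaling the
rows of the A i by diagonal matrices with product 1 does not change the unit
tensor, and scales the columns of the top blocks of the N_i; this makes the
diagonal entries equal to 1 for i != i0 if they are nonzero. *)
Lemma restricts_family (T : tensor K n) (A : forall i, 'M[K]_(r, n i)) :
  tensor_act A T = unit_tensor K k r ->
  (forall i, A i *m (pid_mx r : 'M_(r, n i))^T \in unitmx) ->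
  (forall i j, i != i0 -> invmx (A i *m (pid_mx r : 'M_(r, n i))^T) j j != 0) ->
  exists2 u, normalized u & family_tensor u = T.
Proof.
move=> AT unitA diagA.
pose C i := invmx (A i *m (pid_mx r : 'M_(r, n i))^T).
pose c i j : K := if i == i0 then (\prod_(i' | i' != i0) C i' j j)^-1 else C i j j.
have prodc j : \prod_i c i j = 1.
  rewrite (bigD1 i0) //= {1}/c eqxx [X in _ * X](eq_bigr (fun i => C i j j)) => [|i /negPf ii0].
    by rewrite mulVf //; apply/prodf_neq0 => i; apply: diagA.
  by rewrite /c ii0.
have c_neq0 i j : c i j != 0.
  rewrite /c; have [_|ii0] := eqVneq i i0; last exact: diagA.
  by rewrite invr_eq0; apply/prodf_neq0 => i'; apply: diagA.
pose dg i := diag_mx (\row_j c i j).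
pose A' i := dg i *m A i.
have A'T : tensor_act A' T = unit_tensor K k r.
  apply/ffunP => a; rewrite /A' -tensor_act_comp AT.
  transitivity ((\prod_i c i (a i)) * unit_tensor K k r a).
    rewrite ffunE (bigD1 a) //= [X in _ + X]big1 ?addr0 => [|b ba].
      by congr (_ * _); apply: eq_bigr => i _; rewrite !mxE eqxx.
    have [i ab] := neq_midx ba.
    by rewrite (bigD1 i) //= !mxE eq_sym (negPf ab) mulr0n !mul0r.
  rewrite unit_tensorE //; case: diagonalP => [[j aj]|_]; last by rewrite mulr0.
  by under eq_bigr => i _ do rewrite aj; rewrite prodc mulr1.
have unitd i : dg i \in unitmx.
  rewrite unitmxE det_diag unitfE; apply/prodf_neq0 => j _; rewrite mxE; exact: c_neq0.
pose M i : 'M[K]_(n i) := \matrix_(x, l)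
  if insub (val x) is Some x' then A' i x' l else (x == l)%:R.
have Mtop i (x : 'I_r) l : M i (widen_ord (rn i) x) l = A' i x l by rewrite mxE /= valK.
have Mlow i (x : 'I_(n i)) l : (r <= x)%N -> M i x l = (x == l)%:R.
  by move=> rx; rewrite mxE insubF // ltnNge rx.
have unitA' i : A' i *m (pid_mx r : 'M_(r, n i))^T \in unitmx.
  by rewrite /A' -mulmxA unitmx_mul unitd unitA.
have invN i := block_upper_inverse (rn := rn i) (unitA' i) (@Mtop i) (@Mlow i).
have exN i : exists Ni : 'M[K]_(n i), Ni *m M i = 1%:M /\
    (forall x l, Ni (widen_ord (rn i) x) (widen_ord (rn i) l) =
       invmx (A' i *m (pid_mx r : 'M_(r, n i))^T) x l) /\
    (forall x l : 'I_(n i), (r <= x)%N -> Ni x l = (x == l)%:R).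
  by have [Ni NM Nspec] := invN i; exists Ni.
have [N N_spec] := dependent_choice_fun exN.
pose S := tensor_act M T.
pose u (q : parameter) : K := match q with
  | inl b => S b
  | inr (existT i (x, l)) => N i (widen_ord (rn i) x) l end.
exists u.
  case=> [a|[i [x l]]] /=.
    rewrite negbK => /in_boxP[p ->]; rewrite diag_in_boxE -unit_tensorE // -A'T.
    rewrite !ffunE; apply: eq_bigr => b _; congr (_ * _).
    by apply: eq_bigr => i _; rewrite ffunE Mtop.
  rewrite negb_or negbK => /andP[ii0 /eqP lx].
  have -> : l = widen_ord (rn i) x by apply: val_inj.
  have [_ [-> _]] := N_spec i.
  rewrite /A' -mulmxA invmx_mul ?unitd ?unitA //.
  have -> : invmx (dg i) = diag_mx (\row_j (c i j)^-1).
    rewrite -[LHS]mulmx1; apply: (canLR (mulKmx (unitd i))).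
    apply/matrixP => y z; rewrite mul_diag_mx !mxE; case: eqP => _.
      by rewrite !mulr1n mulfV.
    by rewrite !mulr0n mulr0.
  rewrite mul_mx_diag !mxE /c (negPf ii0) mulfV //; exact: diagA.
rewrite family_tensorE.
have -> : [ffun b => u (inl b)] = S by apply/ffunP => b; rewrite ffunE.
rewrite /S tensor_act_comp (eq_tensor_act (B := fun i => 1%:M)) ?tensor_act1 // => i.
have [<- [_ Nlow]] := N_spec i; congr (_ *m _); apply/matrixP => x l; rewrite mxE.
have [rx|xr] := leqP r x; first by rewrite factor_entry_low // Nlow.
have -> : x = widen_ord (rn i) (Ordinal xr) by apply: val_inj.
by rewrite factor_entry_top.
Qed.

Definition free_parameter : finType := {q : parameter | is_free q}.
Definition num_free_parameters := #|free_parameter|.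

Definition generic_parameter (q : parameter) : {mpoly K[num_free_parameters]} :=
  if insub q is Some s then 'X_(enum_rank (s : free_parameter)) else (fixed_value q)%:MP.

Definition generic_member (a : 'I_#|midx n|) : {mpoly K[num_free_parameters]} :=
  family_coord generic_parameter (enum_val a).

Lemma meval_family (w : parameter -> {mpoly K[num_free_parameters]}) p a :
  (family_coord w a).@[p] = family_coord (fun q => (w q).@[p]) a.
Proof.
rewrite /family_coord raddf_sum; apply: eq_bigr => b _; rewrite /= mevalM rmorph_prod /=.
congr (_ * _); apply: eq_bigr => i _; rewrite /factor_entry; case: insubP => [x _ _|_] //.
by rewrite rmorph_nat.
Qed.

Lemma normalized_meval p : normalized (fun q => (generic_parameter q).@[p]).
Proof. by move=> q qfix; rewrite /generic_parameter insubN // mevalC. Qed.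

Lemma normalizedP u : normalized u -> exists p, forall q, (generic_parameter q).@[p] = u q.
Proof.
move=> norm_u; exists (fun s => u (val (enum_val s))) => q.
rewrite /generic_parameter; case: insubP => [s _ <-|qfix]; first by rewrite mevalXU enum_rankK.
by rewrite mevalC norm_u.
Qed.

Lemma peval_generic_member g p :
  (msubst generic_member g).@[p] = peval g (family_tensor (fun q => (generic_parameter q).@[p])).
Proof.
rewrite meval_msubst; apply: meval_eq => a.
by rewrite meval_family ffunE.
Qed.

(** If g vanishes on the tensors of subrank at least r, it vanishes on the family
where the N_i are invertible, hence identically. Conversely, let g vanish on
the family and let A restrict T to the unit tensor. After an invertible change
of coordinates of T, [restricts_family] applies: by completion of A i to Y i,
this is the case for the change of coordinates Y. On the line N s that joins 1
(s = 0) to Y (s = 1), the conditions of [restricts_family] are the nonvanishing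
of the polynomial function good, nonzero at 1; so g vanishes on all of
N s T, and on T for s = 0. *)
Lemma ideal_of_subrank_ge g :
  vanishing_ideal (subrank_ge K n r) g <-> msubst generic_member g = 0.
Proof.
split=> [gC|g0 T /subrank_geP[//|A AT]].
  pose Delta := \prod_i \det (\matrix_(x, l) factor_entry generic_parameter (i := i) x l).
  have DeltaE p : Delta.@[p] =
      \prod_i \det (\matrix_(x, l) factor_entry (fun q => (generic_parameter q).@[p]) (i := i) x l).
    rewrite rmorph_prod; apply: eq_bigr => i _; rewrite -det_map_mx; congr (\det _).
    apply/matrixP => x l; rewrite !mxE /factor_entry; case: insubP => [y _ _|_] //.
    by rewrite rmorph_nat.
  have Delta0 : Delta != 0.
    pose u (q : parameter) : K := match q with
      | inl a => fixed_value (inl a)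
      | inr (existT i (x, l)) => (l == x :> nat)%:R end.
    have /normalizedP[p pE] : normalized u.
      case=> [a|[i [x l]]] //=; rewrite negb_or negbK => /andP[_ /eqP ->].
      by rewrite eqxx.
    apply: contraTneq (oner_neq0 K) => Delta0; rewrite negbK.
    suff <- : Delta.@[p] = 1 by rewrite Delta0 meval0.
    rewrite DeltaE big1 // => i _; rewrite -(det1 K (n i)); congr (\det _).
    apply/matrixP => x l; rewrite !mxE /factor_entry; case: insubP => [y _ yx|_] //.
    by rewrite pE /= yx eq_sym.
  suff : msubst generic_member g * Delta = 0.
    by move/eqP; rewrite mulf_eq0 (negPf Delta0) orbF => /eqP.
  apply: (mpoly_ext charK) => p; rewrite meval0 mevalM peval_generic_member.
  have [->|Deltap] := eqVneq Delta.@[p] 0; first by rewrite mulr0.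
  rewrite gC ?mul0r //; apply/subrank_geP => //; apply: family_subrank => [|i].
    exact: normalized_meval.
  rewrite unitmxE unitfE; move: Deltap; rewrite DeltaE => /prodf_neq0; exact.
have freeA i := restricts_unit_free k_ge2 i AT.
have exY i : exists Y : 'M[K]_(n i), Y \in unitmx /\ A i = pid_mx r *m Y.
  by have [Y uY AY] := free_completion (rn i) (freeA i); exists Y.
have [Y Y_spec] := dependent_choice_fun exY.
pose P i : 'M[K]_(r, n i) := pid_mx r.
pose N s i : 'M[K]_(n i) := (1 - s)%:M + s *: Y i.
pose B s i : 'M[K]_r := A i *m \adj (N s i) *m (P i)^T.
pose good s := \prod_i (\det (N s i) * \det (B s i) * \prod_j (\adj (B s i)) j j).
pose phi s := peval g (tensor_act (N s) T).
have polyN i x l : polyfun (fun s => N s i x l).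
  have -> : (fun s => N s i x l) = (fun s => (1 + (-1) * s) * (x == l)%:R + s * Y i x l).
    by apply/funext => s; rewrite !mxE mulN1r mulr_natr.
  apply: polyfunD; apply: polyfunM; rewrite -?/(polyfun id);
    try exact: polyfun_cst; try exact: polyfun_id.
  apply: polyfunD; first exact: polyfun_cst.
  by apply: polyfunM; [exact: polyfun_cst | exact: polyfun_id].
have polyB i x l : polyfun (fun s => B s i x l).
  apply: polyfun_mulmx => x' l'; last exact: polyfun_cst.
  apply: polyfun_mulmx => y z; first exact: polyfun_cst.
  by apply: polyfun_adj => ? ?; apply: polyN.
have poly_good : polyfun good.
  apply: polyfun_prod => i; apply: polyfunM; first apply: polyfunM.
  - by apply: polyfun_det => ? ?; apply: polyN.
  - by apply: polyfun_det => ? ?; apply: polyB.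
  - by apply: polyfun_prod => j; apply: polyfun_adj => ? ?; apply: polyB.
have poly_phi : polyfun phi.
  rewrite /phi /peval.
  apply: (@polyfun_meval K _ g (fun a s => tensor_act (N s) T (enum_val a))) => a.
  have -> : (fun s => tensor_act (N s) T (enum_val a)) = (fun s =>
      \sum_(b : midx n) (\prod_(i < k) N s i (enum_val a i) (b i)) * T b).
    by apply/funext => s; rewrite ffunE.
  apply: polyfun_sum => b; apply: polyfunM; last exact: polyfun_cst.
  by apply: polyfun_prod => i; apply: polyN.
have good1 : good 1 != 0.
  have N1 i : N 1 i = Y i by rewrite /N subrr raddf0 add0r scale1r.
  have B1 i : B 1 i = (\det (Y i))%:M.
    rewrite /B N1; have [_ ->] := Y_spec i; rewrite -mulmxA -mulmxA [Y i *m _]mulmxA mul_mx_adj.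
    by rewrite mul_scalar_mx -scalemxAr pid_projK // scalemx1.
  have dY i : \det (Y i) != 0 by have [uY _] := Y_spec i; rewrite -unitfE -unitmxE.
  apply/prodf_neq0 => i _; rewrite N1 B1 !mulf_neq0 //.
    by rewrite det_scalar expf_neq0.
  apply/prodf_neq0 => j _.
  have : (\det (Y i))%:M *m \adj ((\det (Y i))%:M : 'M[K]_r) = (\det (Y i) ^+ r)%:M.
    by rewrite mul_mx_adj det_scalar.
  rewrite mul_scalar_mx => /matrixP/(_ j j); rewrite !mxE eqxx mulr1n => e.
  by apply: contraNneq (expf_neq0 r (dY i)) => adj0; rewrite -e adj0 mulr0.
have phi_good s : good s != 0 -> phi s = 0.
  move=> /prodf_neq0 goods.
  have dN i : \det (N s i) != 0.
    by have := goods i isT; rewrite !mulf_eq0 !negb_or => /andP[/andP[]].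
  have uN i : N s i \in unitmx by rewrite unitmxE unitfE.
  have dB i : \det (B s i) != 0.
    by have := goods i isT; rewrite !mulf_eq0 !negb_or => /andP[/andP[]].
  have adjB i j : (\adj (B s i)) j j != 0.
    have := goods i isT; rewrite !mulf_eq0 !negb_or => /andP[_ /prodf_neq0]; exact.
  have CB i : A i *m invmx (N s i) *m (P i)^T = (\det (N s i))^-1 *: B s i.
    by rewrite /invmx uN /B -scalemxAr -scalemxAl.
  have [|||u norm_u uT] := @restricts_family (tensor_act (N s) T) (fun i => A i *m invmx (N s i)).
  - by rewrite tensor_act_comp -[RHS]AT; apply: eq_tensor_act => i; rewrite mulmxKV.
  - by move=> i; rewrite CB unitmxE detZ unitfE mulf_neq0 // expf_neq0 // invr_eq0.
  - move=> i j _; rewrite CB.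
    have uC : (\det (N s i))^-1 *: B s i \in unitmx.
      by rewrite unitmxE detZ unitfE mulf_neq0 // expf_neq0 // invr_eq0.
    rewrite invmxZ // invrK mxE mulf_neq0 // /invmx unitmxE unitfE dB mxE.
    by rewrite mulf_neq0 // invr_eq0.
  have [p pE] := normalizedP norm_u.
  have := congr1 (meval p) g0; rewrite peval_generic_member meval0 => e.
  rewrite /phi -uT -[RHS]e; congr (peval _ _).
  by congr family_tensor; apply/funext => q; rewrite pE.
have := polyfun_vanish charK poly_phi poly_good good1 phi_good 0.
rewrite /phi; suff -> : tensor_act (N 0) T = T by [].
rewrite -[RHS]tensor_act1; apply: eq_tensor_act => i.
by rewrite /N subr0 scale0r addr0.
Qed.

End Parametrization.

(** * The two cases of maximal rank *)

Lemma smaller_summands k (m : 'I_k -> nat) c : (c <= \sum_i m i)%N ->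
  exists2 m' : 'I_k -> nat, (forall i, (m' i <= m i)%N) & (\sum_i m' i = c)%N.
Proof.
elim: c => [_|c IHc cm]; first by exists (fun=> 0%N) => //; rewrite big1.
have [m' m'm sum_m'] := IHc (ltnW cm).
have [i lti] : exists i, (m' i < m i)%N.
  apply/existsP; apply: contraLR cm; rewrite negb_exists -leqNgt -sum_m' => /forallP mm'.
  by apply: leq_sum => i _; rewrite leqNgt.
exists (fun j => (j == i) + m' j)%N => [j|].
  by have [->|_] := eqVneq j i; rewrite ?add1n ?add0n.
by rewrite big_split /= sum_m' (bigD1 i) //= eqxx big1 // => j /negPf->.
Qed.

Section IndependentLinesNat.
Variables (K : fieldType) (charK : [pchar K] =i pred0).
Variables (k r : nat) (k_ge3 : (3 <= k)%N) (x0 : 'I_r) (m : 'I_k -> nat).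
Notation point := (midx (fun _ : 'I_k => r)).
Let num_far := #|[set a : point | ~~ near_diag a]|.
Let i0 : 'I_k := Ordinal (ltn_trans (isT : (0 < 2)%N) k_ge3).

(** Shrink or increase the m i to make the system square. The W i j exist for all
natural numbers j, the values for j >= m' i being 0. *)
Lemma exists_transverse_lines :
  exists W : 'I_k -> nat -> point -> K,
  [/\ forall i j a x, W i j (upd a i x) = W i j a,
      (num_far <= r * \sum_i m i)%N ->
      forall phi : point -> K, (forall a, near_diag a -> phi a = 0) ->
        (forall i j x, (j < m i)%N -> \sum_(a : point | a i == x) W i j a * phi a = 0) ->
        forall a, phi a = 0 &
      (r * \sum_i m i <= num_far)%N ->
      forall kappa : forall i, 'I_(m i) -> 'I_r -> K,
        (forall a : point, ~~ near_diag a ->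
           \sum_i \sum_(j < m i) kappa i j (a i) * W i j a = 0) ->
        forall i j x, kappa i j x = 0].
Proof.
have r_gt0 : (0 < r)%N by apply: leq_ltn_trans (ltn_ord x0).
pose c := #|[set a : point | ~~ near_diag a & a i0 == x0]|.
have rc : (r * c = num_far)%N := card_slice i0 x0.
pose Wn (m' : 'I_k -> nat) (W : forall i, 'I_(m' i) -> point -> K) i j a :=
  if insub j is Some j' then W i j' a else 0.
have [m' [sum_m' m'm m'm']] : exists m' : 'I_k -> nat,
    [/\ (\sum_i m' i = c)%N, (num_far <= r * \sum_i m i)%N -> forall i, (m' i <= m i)%N &
        (r * \sum_i m i <= num_far)%N -> forall i, (m i <= m' i)%N].
  rewrite -rc !leq_pmul2l //; have [cm|mc] := leqP c (\sum_i m i).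
    have [m' m'm sum_m'] := smaller_summands cm; exists m'; split=> // mc i.
    have e : (\sum_i m' i = \sum_i m i)%N by apply/eqP; rewrite eqn_leq sum_m' cm mc.
    rewrite leqNgt; apply/negP => lti; move: e; apply/eqP; rewrite neq_ltn; apply/orP; left.
    rewrite (bigD1 i) //= [X in (_ < X)%N](bigD1 i) //= -addSn leq_add //.
    by apply: leq_sum => i' _.
  have sumE e : (\sum_(i < k) (i == i0) * e = e)%N.
    by rewrite (bigD1 i0) // eqxx mul1n big1 => [|i /negPf-> //]; exact: addn0.
  exists (fun i => (i == i0) * (c - \sum_i m i) + m i)%N; split=> [||_ i]; last exact: leq_addl.
    rewrite big_split /= sumE subnK // ltnW //.
  by [].
have count : (r * \sum_i m' i = #|[set a : point | ~~ near_diag a]|)%N by rewrite sum_m'.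
have [W [Winv Wphi Wkappa]] := exists_independent_lines charK k_ge3 x0 count.
exists (Wn m' W); split=> [i j a x|/m'm le_m'm phi phi_diag phi_w|/m'm' le_mm' kappa kW i j x].
- by rewrite /Wn; case: insubP.
- apply: Wphi => // i j x; rewrite -[RHS](phi_w i j x); last exact: leq_trans (ltn_ord j) _.
  by apply: eq_bigr => a _; rewrite /Wn valK.
pose kappa' i (j : 'I_(m' i)) x : K := if insub (val j) is Some j' then kappa i j' x else 0.
have := Wkappa kappa' _ i (widen_ord (le_mm' i) j) x; rewrite /kappa' /= valK; apply => a nda.
rewrite -[RHS](kW a nda); apply: eq_bigr => i' _.
pose G j := (if insub j is Some j' then kappa i' j' (a i') else 0) * Wn m' W i' j a.
transitivity (\sum_(j < m i') G j); last first.
  by apply: eq_bigr => j' _; rewrite /G valK.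
rewrite (big_ord_widen (m' i') G) // [RHS]big_mkcond; apply: eq_bigr => j' _.
rewrite /G /Wn valK; case: ifP => // j'm; rewrite insubF ?mul0r //.
Qed.

End IndependentLinesNat.

(** * The Jacobian of the parametrization *)

Lemma mderiv_prod (K : fieldType) n s (I : finType) (h : I -> {mpoly K[n]}) :
  mderiv s (\prod_i h i) = \sum_i mderiv s (h i) * \prod_(j | j != i) h j.
Proof.
pose T i := mderiv s (h i).
suff : forall r : seq I, uniq r -> mderiv s (\prod_(i <- r) h i) =
    \sum_(i <- r) mderiv s (h i) * \prod_(j <- r | j != i) h j.
  by move/(_ _ (index_enum_uniq I)).
elim=> [|i r IHr] /=; first by rewrite !big_nil -mpolyC1 mderivC.
case/andP=> ir ur; rewrite !big_cons eqxx /= mderivM IHr //.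
rewrite -[X in _ = _ * X + _]big_filter; have -> : [seq j <- r | j != i] = r.
  by apply/all_filterP/allP => j jr; apply: contraNneq ir => <-.
congr (_ + _); rewrite mulr_sumr !big_seq; apply: eq_bigr => j jr.
have ij : i != j by apply: contraNneq ir => ->.
by rewrite big_cons ij mulrCA.
Qed.

Section Jacobian.
Variables (K : fieldType) (k : nat) (k_ge3 : (3 <= k)%N) (n : 'I_k -> nat) (r : nat).
Hypothesis rn : forall i, (r <= n i)%N.
Variables (i0 : 'I_k) (x0 : 'I_r).
Notation point := (midx (fun _ : 'I_k => r)).
Notation params := (parameter n r).
Notation free_params := (free_parameter n r i0).

Lemma sum_par (S : Type) (idx : S) (op : Monoid.com_law idx) (f : params -> S) :
  \big[op/idx]_q f q =
  op (\big[op/idx]_b f (inl b))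
     (\big[op/idx]_(i < k) \big[op/idx]_(x < r) \big[op/idx]_(l < n i) f (matrix_parameter x l)).
Proof.
rewrite big_sumType /=; congr (op _ _).
under [RHS]eq_bigr => i _ do rewrite pair_bigA /=.
by rewrite sig_big_dep /=; apply: eq_bigr => -[i [x l]].
Qed.

Definition unbox (a : midx n) : point := finfun (fun i => insubd x0 (val (a i))).

Lemma boxK p : unbox (box rn p) = p.
Proof.
apply: eq_midx => i; apply: val_inj; rewrite !ffunE /= val_insubd.
by rewrite ltn_ord.
Qed.

Lemma unboxK a : in_box r a -> box rn (unbox a) = a.
Proof. by case/(in_boxP rn) => p ->; rewrite boxK. Qed.

Lemma sum_box (f : midx n -> K) : (forall a, ~~ in_box r a -> f a = 0) ->
  \sum_a f a = \sum_p f (box rn p).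
Proof.
move=> f0; rewrite (bigID (in_box r)) /= [X in _ + X]big1 ?addr0 //.
rewrite (reindex_onto (box rn) unbox) /=; last exact: unboxK.
by apply: eq_bigl => p; rewrite box_in boxK eqxx.
Qed.

Lemma upd_box p i x : upd (box rn p) i (widen_ord (rn i) x) = box rn (upd p i x).
Proof.
apply: eq_midx => j; rewrite [RHS]ffunE; have [->|ji] := eqVneq j i.
  by rewrite !upd_same.
by rewrite !upd_other // ffunE.
Qed.

(** The last n i - r indices, following those of the box. *)
Lemma high_proof i (j : 'I_(n i - r)) : (r + j < n i)%N.
Proof. by rewrite -ltn_subRL. Qed.
Definition high i (j : 'I_(n i - r)) : 'I_(n i) := Ordinal (high_proof j).

Lemma sum_low_high i (f : 'I_(n i) -> K) :
  \sum_l f l = \sum_(x < r) f (widen_ord (rn i) x) + \sum_(j < n i - r) f (high j).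
Proof.
have e : (r + (n i - r) = n i)%N by rewrite subnKC.
rewrite (reindex (cast_ord e)) /=; last first.
  by apply: onW_bij; exists (cast_ord (esym e)) => l; rewrite ?cast_ordK ?cast_ordKV.
by rewrite big_split_ord /=; congr (_ + _); apply: eq_bigr => j _; congr f; apply: val_inj.
Qed.

Variable W : 'I_k -> nat -> point -> K.
Hypothesis Winv : forall i j a x, W i j (upd a i x) = W i j a.

(** The point of the parameter space where the Jacobian is computed: the N_i are
identities, S is the unit tensor in the box, and W i j at the points whose i-th
coordinate is r + j while the others are in the box. These are the points that
moving one coordinate can bring into the box. *)
Definition base_parameter (q : params) : K :=
  match q with
  | inl a => if in_box r a then (diag_in_box r a)%:R
             else if [pick i | (r <= a i)%N] is Some i then W i (a i - r) (unbox a) else 0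
  | inr (existT i (x, l)) => (l == x :> nat)%:R
  end.

#[local] Arguments base_parameter : simpl never.

Lemma base_parameter_normalized : normalized i0 base_parameter.
Proof.
case=> [a|[i [x l]]]; rewrite /base_parameter /= ?negb_or negbK; first by move=> ->.
by case/andP=> _ /eqP->; rewrite eqxx.
Qed.

Lemma base_low p i x : base_parameter (inl (upd (box rn p) i (widen_ord (rn i) x))) =
  (diagonal (upd p i x))%:R.
Proof. by rewrite upd_box /base_parameter box_in diag_in_boxE. Qed.

Lemma base_high p i (j : 'I_(n i - r)) :
  base_parameter (inl (upd (box rn p) i (high j))) = W i j p.
Proof.
set a := upd _ _ _; have ai : (a i : nat) = (r + j)%N by rewrite /a upd_same.
have aj i' : i' != i -> (a i' < r)%N by move=> ii; rewrite /a upd_other // ffunE /= ltn_ord.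
have -> /= : base_parameter (inl a) =
    if [pick i | (r <= a i)%N] is Some i then W i (a i - r) (unbox a) else 0.
  by rewrite /base_parameter ifN //; apply/forallPn; exists i; rewrite ai -leqNgt leq_addr.
case: pickP => [i' ri'|/(_ i)]; last by rewrite ai leq_addr.
have -> : i' = i by apply: contraTeq ri' => /aj; rewrite ltnNge.
rewrite ai addKn -(@Winv i j p (insubd x0 (r + j)%N)); congr W.
apply: eq_midx => i''; have [->|ii] := eqVneq i'' i.
  by rewrite upd_same ffunE; congr insubd; exact: ai.
by rewrite upd_other // ffunE /a upd_other // ffunE /= valKd.
Qed.

(** The derivative of the family at the base point: an entry of S moves this entry
of the tensor, and the entry (x, l) of N_i adds the slice l of S to the slice x. *)
Definition jacobian (q : params) (a : midx n) : K :=
  match q with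
  | inl b => (b == a)%:R
  | inr (existT i (x, l)) => (a i == x :> nat)%:R * base_parameter (inl (upd a i l))
  end.

Lemma factor_entry_base i (x l : 'I_(n i)) : factor_entry base_parameter x l = (x == l)%:R.
Proof.
by rewrite /factor_entry; case: insubP => [y _ yx|//]; rewrite /base_parameter /= yx eq_sym.
Qed.

Lemma mderiv_generic_parameter (s : free_params) q :
  mderiv (enum_rank s) (generic_parameter K i0 q) = (q == val s)%:R.
Proof.
rewrite /generic_parameter; case: insubP => [t _ <-|qfix].
  by rewrite mderiv_var (inj_eq enum_rank_inj) (inj_eq val_inj).
by rewrite mderivC; case: eqP => // e; rewrite e (valP s) in qfix.
Qed.

Definition hits (q : params) i (x l : 'I_(n i)) : bool :=
  if insub (val x) is Some x' then matrix_parameter x' l == q else false.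
#[local] Arguments hits : simpl never.

Lemma hits_inl b i (x l : 'I_(n i)) : hits (inl b) x l = false.
Proof. by rewrite /hits; case: insubP. Qed.

Lemma hits_matrix i (x l : 'I_(n i)) x1 l1 :
  hits (matrix_parameter x1 l1) x l = (x == x1 :> nat) && (l == l1).
Proof.
rewrite /hits; case: insubP => [x' _ e|xr].
  rewrite -e /=; apply/eqP/andP => [[-> /eqP]|[/eqP/val_inj-> /eqP->] //].
  by rewrite eq_Tagged /= => ->.
by case: eqP => // e; move: xr; rewrite /= e ltn_ord.
Qed.

Lemma hits_other i (x l : 'I_(n i)) i1 (x1 : 'I_r) (l1 : 'I_(n i1)) : i != i1 ->
  hits (matrix_parameter x1 l1) x l = false.
Proof.
move=> /eqP ii; rewrite /hits; case: insubP => // x' _ _; apply/eqP => e; apply: ii.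
by have := congr1 (fun q : params => if q is inr t then tag t else i) e.
Qed.

Lemma mderiv_factor_entry (s : free_params) i (x l : 'I_(n i)) :
  mderiv (enum_rank s) (factor_entry (generic_parameter K i0) x l) = (hits (val s) x l)%:R.
Proof.
rewrite /factor_entry /hits; case: insubP => [y _ yx|_]; first exact: mderiv_generic_parameter.
by rewrite -mpolyC_nat mderivC.
Qed.

Lemma mderiv_family (p : 'I_(num_free_parameters n r i0) -> K) (s : free_params) a :
  (forall q, (generic_parameter K i0 q).@[p] = base_parameter q) ->
  (mderiv (enum_rank s) (family_coord (generic_parameter K i0) a)).@[p] = jacobian (val s) a.
Proof.
move=> pE; rewrite /family_coord mderiv_bigsum raddf_sum /=.
have factor_entryE i (x l : 'I_(n i)) :
    (factor_entry (generic_parameter K i0) x l).@[p] = (x == l)%:R.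
  rewrite -factor_entry_base /factor_entry; case: insubP => [y _ _|_]; first exact: pE.
  by rewrite rmorph_nat.
have deltaE (b : midx n) : \prod_(i < k) ((a i == b i)%:R : K) = (b == a)%:R.
  have [->|/neq_midx[i ab]] := eqVneq b a; first by rewrite big1 // => i _; rewrite eqxx.
  by rewrite (bigD1 i) //= eq_sym (negPf ab) mul0r.
transitivity (\sum_(b : midx n) (\sum_(i < k)
    (hits (val s) (a i) (b i))%:R * \prod_(j | j != i) (a j == b j)%:R * base_parameter (inl b)
    + (b == a)%:R * (inl b == val s)%:R)).
  apply: eq_bigr => b _; rewrite mderivM mevalD !mevalM pE mderiv_generic_parameter rmorph_nat.
  rewrite mderiv_prod rmorph_prod raddf_sum /= mulr_suml; congr (_ + _ * _).
    apply: eq_bigr => i _; rewrite mevalM mderiv_factor_entry rmorph_nat rmorph_prod /=.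
    by congr (_ * _ * _); apply: eq_bigr => j _; apply: factor_entryE.
  by rewrite -deltaE; apply: eq_bigr => i _; apply: factor_entryE.
rewrite big_split /= [X in _ + X](bigD1 a) //= eqxx mul1r [X in _ + (_ + X)]big1 ?addr0; last first.
  by move=> b /negPf->; rewrite mul0r.
case: (val s) => [b0|[i1 [x1 l1]]]; rewrite /jacobian.
  rewrite big1 ?add0r => [|b _]; first by rewrite eq_sym.
  by apply: big1 => i _; rewrite hits_inl !mul0r.
rewrite [(_ == _)%:R](_ : _ = 0) // addr0 exchange_big (bigD1 i1) //=.
rewrite [X in _ + X]big1 ?addr0; last first.
  by move=> i ii1; apply: big1 => b _; rewrite (hits_other _ _ _ _ ii1) !mul0r.
under eq_bigr => b _ do rewrite hits_matrix.
rewrite (bigD1 (upd a i1 l1)) //= upd_same eqxx andbT [X in _ + X]big1 ?addr0 => [|b nb].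
  by rewrite big1 ?mulr1 // => j ji; rewrite upd_other // eqxx.
have [e|] := eqVneq (b i1) l1; last by rewrite andbF !mul0r.
have [j ji ab] : exists2 j, j != i1 & a j != b j.
  have [j] := neq_midx nb.
  have [->|ji] := eqVneq j i1; first by rewrite upd_same e eqxx.
  by rewrite upd_other // => ba; exists j; rewrite // eq_sym.
by rewrite (bigD1 j) //= (negPf ab) !(mulr0, mul0r).
Qed.

Let m i := (n i - r)%N.

Let const (l : 'I_r) : point := finfun (fun _ => l).

Lemma other_index (i i' : 'I_k) : exists2 j, j != i & j != i'.
Proof.
have [j] : exists j, j \notin [:: i; i'] by apply: avoid_seq.
by rewrite !inE negb_or => /andP[]; exists j.
Qed.

Lemma diagonal_upd (i : 'I_k) (p : point) x l :
  p i = x -> diagonal (upd p i l) = (p == upd (const l) i x).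
Proof.
move=> px; apply/diagonalP/eqP => [[c pc]|->].
  have lc : l = c by have := pc i; rewrite upd_same.
  apply: eq_midx => j; have [->|ji] := eqVneq j i; first by rewrite upd_same.
  by have := pc j; rewrite !upd_other // ffunE lc.
exists l => j; have [->|ji] := eqVneq j i; first by rewrite upd_same.
by rewrite !upd_other // ffunE.
Qed.

Lemma near_diag_upd (p : point) i l : diagonal (upd p i l) -> near_diag p.
Proof.
case/diagonalP => c pc; apply/near_diagP; exists i, c => j ji.
by rewrite -(pc j) upd_other.
Qed.

Lemma diagonal_upd2 i1 x1 l0 i x : diagonal (upd (upd (const l0) i1 x1) i x) ->
  x = l0 /\ (i = i1 \/ x1 = l0).
Proof.
case/diagonalP=> c pc; have [j ji ji1] := other_index i i1.
have lc : l0 = c by have := pc j; rewrite !upd_other // ffunE.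
have xc : x = c by have := pc i; rewrite upd_same.
split; first by rewrite lc.
have [->|ii1] := eqVneq i i1; [by left | right].
by have := pc i1; rewrite upd_other 1?eq_sym // upd_same lc.
Qed.

(** A linear form phi that kills the Jacobian vanishes outside the box because of
the entries of S, at near-diagonal points because of the slices l < r, and then
everywhere by the assumption on W because of the slices l >= r. *)
Lemma jacobian_surjective :
  (forall phi : point -> K, (forall a, near_diag a -> phi a = 0) ->
     (forall i j x, (j < m i)%N -> \sum_(a : point | a i == x) W i j a * phi a = 0) ->
     forall a, phi a = 0) ->
  forall phi : midx n -> K,
    (forall s : free_params, \sum_a jacobian (val s) a * phi a = 0) -> forall a, phi a = 0.
Proof.
move=> W_surj phi Jphi.
have {}Jphi q : is_free i0 q -> \sum_a jacobian q a * phi a = 0.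
  by move=> qfree; apply: (Jphi (exist _ q qfree)).
have phi_out b : ~~ in_box r b -> phi b = 0.
  move=> outb; rewrite -[RHS](Jphi (inl b) outb) (bigD1 b) //= eqxx mul1r big1 ?addr0 //.
  by move=> a ab; rewrite eq_sym (negPf ab) mul0r.
have Jbox i (x : 'I_r) (l : 'I_(n i)) : (i == i0) || (l != x :> nat) ->
    \sum_(p : point | p i == x) base_parameter (inl (upd (box rn p) i l)) * phi (box rn p) = 0.
  move=> qfree; rewrite -[RHS](Jphi (matrix_parameter x l) qfree).
  rewrite sum_box => [|a /phi_out->]; last by rewrite mulr0.
  rewrite big_mkcond; apply: eq_bigr => p _; rewrite /= ffunE /= val_eqE.
  by case: eqP; rewrite ?mul1r ?mul0r.
(* The slice l < r of the unit tensor in direction i, moved to the slice x, is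
   supported at the near-diagonal point upd (const l) i x. *)
have phi_const i (x l : 'I_r) : (i == i0) || (l != x) -> phi (box rn (upd (const l) i x)) = 0.
  move=> qfree; rewrite -[RHS](Jbox i x (widen_ord (rn i) l) qfree).
  rewrite (bigD1 (upd (const l) i x)) /=; last by rewrite upd_same.
  rewrite base_low (diagonal_upd _ (upd_same _ _)) eqxx mul1r big1 ?addr0 // => p /andP[/eqP px np].
  by rewrite base_low (diagonal_upd _ px) (negPf np) mul0r.
have phi_box (p : point) : phi (box rn p) = 0.
  apply: (W_surj (fun p => phi (box rn p))) => [{}p /near_diagP[i [l pl]]|i j x jm].
    have p_upd : p = upd (const l) i (p i).
      apply: eq_midx => j; have [->|ji] := eqVneq j i; first by rewrite upd_same.
      by rewrite upd_other // ffunE pl.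
    (* A diagonal point may be approached in any direction, hence in direction i0,
       for which the parameter is free. *)
    have [lp|lp] := eqVneq l (p i); last by rewrite p_upd phi_const // lp orbT.
    have upd_const i' : upd (const l) i' l = const l.
      apply: eq_midx => j; have [->|ji] := eqVneq j i'; first by rewrite upd_same ffunE.
      by rewrite upd_other.
    by rewrite p_upd -lp upd_const -(upd_const i0) phi_const ?eqxx.
  rewrite -[RHS](Jbox i x (high (Ordinal jm))); last first.
    by rewrite neq_ltn /= ltn_addr ?orbT // ltn_ord.
  by apply: eq_bigr => q _; rewrite base_high.
move=> a; have [/(in_boxP rn)[p ->]|/phi_out//] := boolP (in_box r a).
exact: phi_box.
Qed.

(** Let v be in the kernel. At the far points of the box only the slices l >= r
contribute, so that the assumption on W shows that these coordinates of v are
zero. At near-diagonal points one slice l < r contributes, as the others are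
fixed by the normalization; and outside the box, the entry of S does. *)
Lemma jacobian_injective :
  (forall kappa : forall i, 'I_(m i) -> 'I_r -> K,
     (forall a : point, ~~ near_diag a -> \sum_i \sum_(j < m i) kappa i j (a i) * W i j a = 0) ->
     forall i j x, kappa i j x = 0) ->
  forall v : free_params -> K,
    (forall a, \sum_s jacobian (val s) a * v s = 0) -> forall s, v s = 0.
Proof.
move=> W_inj v0 v0J.
pose v (q : params) : K := if insub q is Some s then v0 s else 0.
have v_fixed q : ~~ is_free i0 q -> v q = 0 by move=> qfix; rewrite /v insubN.
have {v0J}vJ a : v (inl a) + \sum_(i < k) \sum_(x < r) \sum_(l < n i)
    v (matrix_parameter x l) * ((a i == x :> nat)%:R * base_parameter (inl (upd a i l))) = 0.
  rewrite -[RHS](v0J a).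
  transitivity (\sum_q v q * jacobian q a); last first.
    rewrite (bigID (is_free i0)) /= [X in _ + X]big1 ?addr0 => [|q /v_fixed->].
    2: by rewrite mul0r.
    rewrite (big_sub (is_free i0) (fun q => v q * jacobian q a)).
    by apply: eq_bigr => s _; rewrite /v valK mulrC.
  rewrite sum_par /=; congr (_ + _); rewrite (bigD1 a) //= eqxx mulr1 big1 ?addr0 // => b /negPf->.
  by rewrite mulr0.
have vbox (p : point) : \sum_(i < k)
    (\sum_(x < r) v (matrix_parameter (p i) (widen_ord (rn i) x)) * (diagonal (upd p i x))%:R
     + \sum_(j < m i) v (matrix_parameter (p i) (high j)) * W i j p) = 0.
  rewrite -[RHS](vJ (box rn p)) v_fixed ?add0r; last by rewrite /= box_in.
  apply: eq_bigr => i _; rewrite [RHS](bigD1 (p i)) //= [X in _ = _ + X]big1 ?addr0; last first.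
    move=> x xp; apply: big1 => l _; rewrite ffunE /= val_eqE eq_sym (negPf xp) mul0r mulr0.
    by [].
  rewrite sum_low_high ffunE /= eqxx; congr (_ + _); apply: eq_bigr => l _; rewrite mul1r.
    by rewrite base_low.
  by rewrite base_high.
have v_high i (j : 'I_(m i)) x : v (matrix_parameter x (high j)) = 0.
  apply: (W_inj (fun i j x => v (matrix_parameter x (high j)))) => p farp.
  rewrite -[RHS](vbox p); apply: eq_bigr => i' _; rewrite [X in _ = X + _]big1 ?add0r // => x' _.
  case: (boolP (diagonal _)) => [/near_diag_upd nd|_]; last by rewrite mulr0.
  by rewrite nd in farp.
have v_low i1 (x1 l0 : 'I_r) : v (matrix_parameter x1 (widen_ord (rn i1) l0)) = 0.
  have [qfree|/v_fixed//] := boolP (is_free i0 (matrix_parameter x1 (widen_ord (rn i1) l0))).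
  pose p := upd (const l0) i1 x1.
  rewrite -[RHS](vbox p) (bigD1 i1) //= (bigD1 l0) //=.
  have -> : diagonal (upd p i1 l0) by rewrite (diagonal_upd _ (upd_same _ _)).
  (* A diagonal p lies on k slices, one for each direction, but the parameter is
     free for direction i0 only. *)
  have term i x : (i, x) <> (i1, l0) ->
      v (matrix_parameter (p i) (widen_ord (rn i) x)) * (diagonal (upd p i x))%:R = 0.
    move=> ne; case: (boolP (diagonal _)) => [/diagonal_upd2[ex [ei|xl]]|_]; last by rewrite mulr0.
      by case: ne; rewrite ex ei.
    rewrite mulr1 v_fixed //= negb_or negbK ex.
    have ii1 : i != i1 by apply: contra_notN ne => /eqP->; rewrite ex.
    move: qfree => /=; rewrite xl eqxx orbF => /eqP <-.
    by rewrite ii1 /p upd_other // ffunE eqxx.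
  rewrite mulr1 [X in _ = _ + X + _ + _]big1 => [|x xl]; last first.
    by apply: term => -[xl']; rewrite xl' eqxx in xl.
  rewrite addr0 upd_same [X in _ = _ + X + _]big1 ?addr0 => [|j _]; last by rewrite v_high mul0r.
  rewrite big1 ?addr0 // => i ii1; rewrite big1 ?add0r => [|x _].
    by rewrite big1 // => j _; rewrite v_high mul0r.
  by apply: term => -[ei _]; rewrite ei eqxx in ii1.
have v_matrix i (x : 'I_r) (l : 'I_(n i)) : v (matrix_parameter x l) = 0.
  have [rl|lr] := leqP r l.
    have jm : (l - r < m i)%N by rewrite ltn_sub2r // (leq_ltn_trans rl).
    by have -> : l = high (Ordinal jm) by [apply: val_inj; rewrite /= subnKC]; apply: v_high.
  by have -> : l = widen_ord (rn i) (Ordinal lr) by [apply: val_inj]; apply: v_low.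
have v_all q : v q = 0.
  case: q => [a|[i [x l]]]; last exact: v_matrix.
  rewrite -[RHS](vJ a) big1 ?addr0 // => i _; apply: big1 => x _; apply: big1 => l _.
  by rewrite v_matrix mul0r.
by move=> s; have := v_all (val s); rewrite /v valK.
Qed.

Lemma card_free_parameters :
  (num_free_parameters n r i0 + r ^ k + (k - 1) * r = \prod_i n i + r * \sum_i n i)%N.
Proof.
have card_fixed : #|[pred q : params | ~~ is_free i0 q]| = (r ^ k + (k - 1) * r)%N.
  rewrite -sum1_card big_mkcond sum_par /=; congr (_ + _)%N.
    rewrite -big_mkcond sum1dep_card.
    have -> : [set a : midx n | ~~ ~~ in_box r a] = [set box rn p | p in [set: point]].
      apply/setP => a; rewrite inE negbK; apply/idP/imsetP => [/(in_boxP rn)[p ->]|[p _ ->]].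
        by exists p.
      exact: box_in.
    rewrite card_imset ?cardsT ?card_midx ?prod_nat_const ?card_ord //.
    exact: box_inj.
  transitivity (\sum_(i < k) (i != i0) * r)%N.
    apply: eq_bigr => i _; transitivity (\sum_(x < r) (i != i0 : nat))%N; last first.
      by rewrite sum_nat_const card_ord mulnC.
    apply: eq_bigr => x _; rewrite (bigD1 (widen_ord (rn i) x)) //= big1 => [|l lx].
      by rewrite inE /= eqxx orbF; case: (i == i0).
    by rewrite inE /= (_ : l != x :> nat) ?orbT //; apply: contraNneq lx => lx; apply/eqP/val_inj.
  rewrite -big_distrl /= (bigD1 i0) //= eqxx add0n; congr (_ * _)%N.
  rewrite (eq_bigr (fun=> 1%N)) => [|i ->//]; rewrite sum1_card.
  by have := cardC1 i0; rewrite card_ord subn1 => <-; apply: eq_card => i; rewrite !inE.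
rewrite -addnA -card_fixed /num_free_parameters.
have -> : #|free_params| = #|[pred q : params | is_free i0 q]| by rewrite card_sig.
have -> : #|[pred q : params | ~~ is_free i0 q]| = #|[predC [pred q : params | is_free i0 q]]|.
  by apply: eq_card.
rewrite cardC card_sum card_midx card_tagged sumnE big_map big_enum /=; congr (_ + _)%N.
by rewrite big_distrr; apply: eq_bigr => i _; rewrite card_prod !card_ord.
Qed.

End Jacobian.

(** * The dimension *)

Theorem theorem4p1 (K : fieldType) (charK : [pchar K] =i pred0)
    (k : nat) (k_ge3 : (3 <= k)%N)
    (n : 'I_k -> nat) (n_gt0 : forall i, (0 < n i)%N)
    (r : nat) (r_gt0 : (0 < r)%N)
    (Qr : (generic_subrank K n < r)%N) (rn : forall i, (r <= n i)%N) :
  (zariski_dim (subrank_ge K n r))%:Z =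
  (\prod_(i < k) (n i)%:Z)
    - r%:Z * (r%:Z ^+ (k - 1)%N - \sum_(i < k) (n i)%:Z + (k%:Z - 1)).
Proof.
have k_ge2 : (2 <= k)%N := ltnW k_ge3.
pose i0 : 'I_k := Ordinal (ltnW k_ge2); pose x0 : 'I_r := Ordinal r_gt0.
have [W [Winv Wsurj Winj]] :=
  exists_transverse_lines charK k_ge3 x0 (fun i => n i - r)%N.
have [p pE] := normalizedP (@base_parameter_normalized K k n r i0 x0 W).
have ideal := ideal_of_subrank_ge charK k_ge2 rn i0.
have jacE (s : free_parameter n r i0) (a : 'I_#|midx n|) :
    (mderiv (enum_rank s) (generic_member K r i0 a)).@[p] = jacobian x0 W (val s) (enum_val a).
  exact: mderiv_family.
have [far_le|far_gt] := leqP #|[set a : midx (fun _ : 'I_k => r) | ~~ near_diag a]|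
  (r * \sum_i (n i - r)).
  have [L Linv] := left_inverse_of_injective
    (@jacobian_surjective K k n r rn i0 x0 W Winv (Wsurj far_le)).
  suff : (r <= generic_subrank K n)%N by rewrite leqNgt Qr.
  apply: (generic_subrank_max k_ge2) => //; apply: zariski_dense_vanishing => g /ideal.
  apply: (jacobian_independence charK
    (L := fun a s => L (enum_val a) (enum_val s)) (p := p)) => a a'.
  rewrite -(inj_eq enum_val_inj) -Linv (reindex enum_rank) /=; last first.
    by apply: onW_bij; apply: enum_rank_bij.
  by apply: eq_bigr => s _; rewrite enum_rankK jacE.
have [R Rinv] := left_inverse_of_injective
  (@jacobian_injective K k k_ge3 n r rn i0 x0 W Winv (Winj (ltnW far_gt))).
have -> : zariski_dim (subrank_ge K n r) = num_free_parameters n r i0.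
  apply: (zariski_dim_parametrized charK (f := generic_member K r i0) (p := p)
    (R := fun a s => R (enum_val s) (enum_val a))) => // s l.
  rewrite -(inj_eq enum_val_inj) eq_sym -Rinv.
  rewrite [RHS](reindex (fun a : 'I_#|midx n| => enum_val a)) /=; last first.
    by apply: onW_bij; apply: enum_val_bij.
  by apply: eq_bigr => a _; rewrite -{1}(enum_valK s) jacE mulrC.
have prodE : (\prod_(i < k) n i)%N%:Z = \prod_(i < k) (n i)%:Z.
  exact: (big_morph Posz PoszM).
have sumE : (\sum_(i < k) n i)%N%:Z = \sum_(i < k) (n i)%:Z.
  exact: (big_morph Posz PoszD).
have powE e : (r ^ e)%N%:Z = r%:Z ^+ e.
  by elim: e => // e IHe; rewrite expnS exprS PoszM IHe.
have predE : (k - 1)%N%:Z = k%:Z - 1 by rewrite subzn // ltnW.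
have := congr1 Posz (card_free_parameters rn i0).
rewrite !PoszD !PoszM powE prodE sumE predE -[in r%:Z ^+ k](subnK (ltnW k_ge2)) addn1 exprS.
move: (num_free_parameters _ _ _)%:Z (\prod_(i < k) (n i)%:Z) (\sum_(i < k) (n i)%:Z) => d P S.
move: (r%:Z) (k%:Z) => r' k' h.
have -> : P = d + r' * r' ^+ (k - 1) + (k' - 1) * r' - r' * S by rewrite h addrK.
by move: (r' ^+ _) => e; ring.
Qed.
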